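(* Let $\mathcal F=\emptyset$, $\kappa=5$, and let $\gamma(H)=0$ for every graph $H$ of order 5 except $\gamma(P_3\cup K_2)=1$, where $P_3\cup K_2$ is the disjoint union of a path on 3 vertices and an edge. Let $B=K_3\cup K_3$ be the disjoint union of two triangles. Then the corresponding problem (the inducibility of $P_3\cup K_2$) is perfectly $B$-stable; moreover $\lim_{n\to\infty}\lambda(n,\mathcal G)=5/18$ and the unique maximiser of $\lambda(B(\mathbf a))$ over $\mathbf a\in\mathbb S_6$ is the vector with each entry $1/6$.
   Context: All graphs are finite and simple; ''subgraph'' means induced subgraph. $P(F,G)$ is the number of $v(F)$-subsets of $V(G)$ inducing a copy of $F$, $p(F,G)=P(F,G)/\binom{v(G)}{v(F)}$. Admissible graphs are those containing no member of $\mathcal F$ as induced subgraph (here all graphs); $\mathcal G$ is the class of admissible graphs. $\Lambda(G)=\sum_H\gamma(H)P(H,G)$ over isomorphism classes $H$ of order-$\kappa$ graphs, $\lambda(G)=\Lambda(G)/\binom{v(G)}\kappa$, $\lambda(n,\mathcal G)=\max\{\lambda(G):G\in\mathcal G,v(G)=n\}$. For a graph $B$ on $[m]$ and disjoint sets $V_1,\dots,V_m$, the blow-up $B(V_1,\dots,V_m)$ has vertex set $\bigcup V_i$, with $u\in V_i,w\in V_j$ adjacent iff $ij\in E(B)$; $B()$ is the family of all blow-ups. $\mathbb S_m$ is the simplex of probability vectors in $\mathbb R^m$; $\lambda(B(\mathbf a))=\lim_{n}\lambda(B(V_{1,n},\dots,V_{m,n}))$ with $|V_{i,n}|=a_in+O(1)$.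 $\delta_{\mathrm{edit}}(G,B())$ is the minimal number of adjacency changes turning $G$ (order $n$) into a blow-up of $B$, divided by $\binom n2$. Perfectly $B$-stable: there is $C>0$ with $\delta_{\mathrm{edit}}(G,B())\le C(\lambda(n,\mathcal G)-\lambda(G))$ for all admissible $G$ of order $n\ge C$. *)

(* Defs.v *)
From HB Require Import structures.
From mathcomp Require Import all_boot all_order all_algebra.
From mathcomp Require Import all_classical all_reals all_analysis.

Set Implicit Arguments.
Unset Strict Implicit.
Unset Printing Implicit Defensive.

Import Order.TTheory GRing.Theory Num.Theory.
Import numFieldNormedType.Exports.

Local Open Scope classical_set_scope.
Local Open Scope ring_scope.

Section Graphs.

Definition simple_arcs (T : finType) (E : {set T * T}) : bool :=
  [forall x, (x, x) \notin E] &&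
  [forall x, forall y, ((x, y) \in E) == ((y, x) \in E)].

(* A graph is stored as its set of ordered adjacent pairs, so that the graphs
   on a finite vertex set form a finite type. *)
Record graph (T : finType) := Graph {
  arcs : {set T * T};
  _ : simple_arcs arcs }.

HB.instance Definition _ (T : finType) := [isSub for @arcs T].
HB.instance Definition _ (T : finType) := [Finite of graph T by <:].

Definition adj (T : finType) (G : graph T) : rel T :=
  fun x y => (x, y) \in arcs G.

Lemma adj_sym (T : finType) (G : graph T) : symmetric (adj G).
Proof.
by case: G => E p x y; have /andP[_ /forallP h] := p; apply/eqP; apply: (forallP (h x) y).
Qed.

Lemma adj_irrefl (T : finType) (G : graph T) : irreflexive (adj G).
Proof. by case: G => E p x; have /andP[/forallP h _] := p; exact/negbTE/(h x). Qed.

Lemma graph_of_subproof (T : finType) (r : rel T) :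
  simple_arcs [set p | (p.1 != p.2) && (r p.1 p.2 || r p.2 p.1)]%SET.
Proof.
apply/andP; split; apply/forallP => x; first by rewrite inE /= eqxx.
by apply/forallP => y; rewrite !inE /= [y == x]eq_sym [r y x || _]orbC.
Qed.

(* The irreflexive and symmetric closure makes this total; it changes nothing
   for a relation that is already irreflexive and symmetric. *)
Definition graph_of (T : finType) (r : rel T) : graph T :=
  Graph (graph_of_subproof r).

Lemma adj_graph_of (T : finType) (r : rel T) (x y : T) :
  adj (graph_of r) x y = (x != y) && (r x y || r y x).
Proof. by rewrite /adj /= inE. Qed.

Definition pullback (T U : finType) (G : graph U) (f : T -> U) : graph T :=
  graph_of (fun x y => adj G (f x) (f y)).

Lemma adj_pullback (T U : finType) (G : graph U) (f : T -> U) (x y : T) :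
  adj (pullback G f) x y = adj G (f x) (f y).
Proof.
rewrite adj_graph_of (adj_sym _ (f y)) orbb.
by case: eqVneq => // ->; rewrite adj_irrefl.
Qed.

Definition induced (T : finType) (G : graph T) (X : {set T}) :
    graph {x : T | x \in X} :=
  pullback G val.

Definition iso (T U : finType) (G : graph T) (H : graph U) : Prop :=
  exists2 f : T -> U, bijective f & forall x y, adj H (f x) (f y) = adj G x y.

Definition complete_graph (n : nat) : graph 'I_n :=
  graph_of (fun x y => x != y).

Definition path_graph (n : nat) : graph 'I_n :=
  graph_of (fun x y : 'I_n => x.+1 == y :> nat).

Definition disjoint_union (m n : nat) (G : graph 'I_m) (H : graph 'I_n) :
    graph 'I_(m + n) :=
  graph_of (fun x y => match fintype.split x, fintype.split y with
                       | inl i, inl j => adj G i j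
                       | inr i, inr j => adj H i j
                       | _, _ => false
                       end).

(* The vertex classes of the blow-up are V_i = c @^-1 i, possibly empty. *)
Definition blowup (m : nat) (T : finType) (B : graph 'I_m) (c : T -> 'I_m) :
    graph T :=
  pullback B c.

Definition blowups (m : nat) (T : finType) (B : graph 'I_m) : set (graph T) :=
  [set blowup B c | c in [set: T -> 'I_m]].

Definition blowup_of_sizes (m : nat) (B : graph 'I_m) (s : 'I_m -> nat) :
    graph {i : 'I_m & 'I_(s i)} :=
  blowup B (fun v => tag v).

(* P(F, G) *)
Definition induced_count (U T : finType) (F : graph U) (G : graph T) : nat :=
  #|[set X : {set T} | (#|X| == #|U|) && `[< iso (induced G X) F >]]%SET|.

Definition graph_family := forall k : nat, set (graph 'I_k).

Definition admissible (FF : graph_family) (T : finType) (G : graph T) : Prop :=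
  forall (k : nat) (F : graph 'I_k), FF k F -> induced_count F G = 0%N.

Definition iso_representatives (k : nat) : {set graph 'I_k} :=
  transversal
    (equivalence_partition (fun G H => `[< iso G H >]) [set: graph 'I_k]%SET)
    [set: graph 'I_k]%SET.

Definition edit_count (T : finType) (G H : graph T) : nat :=
  #|[set e : {set T} | [exists x, exists y,
      (e == [set x; y]) && (adj G x y != adj H x y)]]%SET|.

End Graphs.

Section Problem.
Variables (R : realType) (FF : graph_family).
(* gamma is meant to be invariant under isomorphism. *)
Variables (kappa : nat) (gamma : graph 'I_kappa -> R).

Definition Lambda (T : finType) (G : graph T) : R :=
  \sum_(H in iso_representatives kappa) gamma H * (induced_count H G)%:R.

Definition lambda (T : finType) (G : graph T) : R :=
  Lambda G / 'C(#|T|, kappa)%:R.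

(* The supremum of a finite set, hence a maximum as soon as there is an
   admissible graph of order n. *)
Definition lambda_max (n : nat) : R :=
  sup [set lambda G | G in [set G : graph 'I_n | admissible FF G]].

(* The infimum of a finite set, hence a minimum when 0 < m. *)
Definition edit_distance (m : nat) (T : finType) (G : graph T)
    (B : graph 'I_m) : R :=
  inf [set (edit_count G H)%:R | H in blowups B] / 'C(#|T|, 2)%:R.

Definition perfectly_stable (m : nat) (B : graph 'I_m) : Prop :=
  exists2 C : R, 0 < C &
    forall (n : nat) (G : graph 'I_n), C <= n%:R -> admissible FF G ->
      edit_distance G B <= C * (lambda_max n - lambda G).

Definition simplex (m : nat) : set 'rV[R]_m :=
  [set a | (forall i, 0 <= a 0 i) /\ \sum_i a 0 i = 1].

Definition is_lambda_blowup (m : nat) (B : graph 'I_m) (a : 'rV[R]_m) (l : R)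
    : Prop :=
  forall s : nat -> 'I_m -> nat,
    (exists K : R, forall n i, `|(s n i)%:R - a 0 i * n%:R| <= K) ->
    lambda (blowup_of_sizes B (s n)) @[n --> \oo] --> l.

(* get picks an arbitrary value when the limit does not exist. *)
Definition lambda_blowup (m : nat) (B : graph 'I_m) (a : 'rV[R]_m) : R :=
  get (is_lambda_blowup B a).

Definition is_maximiser (m : nat) (f : 'rV[R]_m -> R) (a : 'rV[R]_m) : Prop :=
  simplex a /\ forall b, simplex b -> f b <= f a.

End Problem.

Definition no_forbidden_graph : graph_family := fun _ => set0.

Definition P3K2 : graph 'I_5 :=
  disjoint_union (path_graph 3) (complete_graph 2).

Definition K3K3 : graph 'I_6 :=
  disjoint_union (complete_graph 3) (complete_graph 3).

Definition gamma_P3K2 (R : realType) (H : graph 'I_5) : R :=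
  if `[< iso H P3K2 >] then 1 else 0.

(* Main.v *)
(* A sum-of-squares flag algebra certificate on five vertices gives, for every
   weighted graph, that the weighted number of induced P3 + K2 is at most its
   conjectured maximum minus a multiple of the number of obstructions, i.e.
   five-tuples spanning no induced subgraph of a blow-up of K3K3.  Counting maps
   (repetitions allowed) instead of subsets makes this exact for finite graphs.

   Any induced 2K2 in G defines a partition into six classes, and each pair
   misplaced with respect to it lies in an obstruction together with vertices
   of the 2K2; averaging over all 2K2 bounds the edit distance by the number of
   obstructions.  If G is nearly extremal, the classes have nearly equal sizes;
   giving them exactly equal weights, the blow-up attains equality in the
   certificate, so that it beats G by a multiple of the number of misplaced
   pairs.  As the weights are close to 1, the same holds without weights. *)

Require Import Defs.
From Stdlib Require Import BinInt.
From mathcomp Require Import all_boot all_order all_algebra.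
From mathcomp Require Import all_classical all_reals all_analysis.
From mathcomp Require Import ssrZ zify ring lra.
Import Order.TTheory GRing.Theory Num.Theory.
Import numFieldNormedType.Exports.
Local Open Scope classical_set_scope.
Local Open Scope ring_scope.

Set Implicit Arguments.
Unset Strict Implicit.
Unset Printing Implicit Defensive.

(** * Five-vertex patterns and the certificate *)

(** Perfect stability leaves no room for an error of order [1/n]: the gap to the true maximum at
    order [n] may be far smaller than the distance of that maximum from 5/18. The flag inequality
    measures only the deficit from [n^5/108], which finite graphs miss by lower-order terms, so by
    itself it gives stability up to such an error. It serves to place [G] near a blow-up; the final
    estimate compares [G] with a blow-up on the same vertex set, and every error term must be a
    small multiple of the number of misplaced pairs. Two errors are made to have this form. Dropping
    the weights perturbs only the five-tuples on which the two graphs disagree. Passing from tuples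
    to subsets leaves a term of order [n^4], the number of ordered induced 2K2; but only its change
    between the two graphs matters, and that is at most [6 n^2] times the misplaced pairs, against a
    gain of order [n^3] times the same number. *)

Notation pattern := (nat -> nat -> bool).

Definition relabel (p : seq nat) (e : pattern) : pattern :=
  fun i j => e (nth 0%N p i) (nth 0%N p j).

Definition P3K2_pattern (e : pattern) : bool :=
  [&& e 0%N 1%N, e 1%N 2%N, e 3%N 4%N, ~~ e 0%N 2%N, ~~ e 0%N 3%N, ~~ e 0%N 4%N,
      ~~ e 1%N 3%N, ~~ e 1%N 4%N, ~~ e 2%N 3%N & ~~ e 2%N 4%N].

(* Up to relabelling: the first four vertices span a path P4 or a triangle with
   a pendant edge, they span a K4, or the five vertices span 2K2 + K1.  These
   are the obstructions to being an induced subgraph of a blow-up of K3K3. *)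
Definition obstruction (e : pattern) : bool :=
  [|| [&& e 0%N 1%N, e 1%N 2%N, e 2%N 3%N, ~~ e 0%N 2%N & ~~ e 0%N 3%N],
      [&& e 0%N 1%N, e 0%N 2%N, e 0%N 3%N, e 1%N 2%N, e 1%N 3%N & e 2%N 3%N] |
      [&& e 0%N 1%N, e 2%N 3%N, ~~ e 0%N 2%N, ~~ e 0%N 3%N, ~~ e 1%N 2%N,
          ~~ e 1%N 3%N, ~~ e 0%N 4%N, ~~ e 1%N 4%N, ~~ e 2%N 4%N & ~~ e 3%N 4%N]].

Delimit Scope Z_scope with BZ.

Section Certificate.

Local Notation "x + y" := (BinInt.Z.add x y).
Local Notation "x * y" := (BinInt.Z.mul x y).
Local Notation "x - y" := (BinInt.Z.sub x y).

(* A pair [(d, l)] stands for [d] times the square of the linear form [l] in the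
   sizes of the eight classes of vertices, classified by their adjacency to the
   three vertices of the type.  All numbers of the certificate are multiplied
   by the common denominator 1157587200. *)
Definition squares := seq (Z * seq Z).

Definition squares_empty : squares :=
  [:: (108372320, [:: 1; -3; -3; 2; -3; 2; 2; -2]);
      (23307840, [:: 3; 2; 2; -5; 2; -5; -5; -6]);
      (3409120, [:: 1; 3; 3; -4; 3; -4; -4; -2])]%BZ.
Definition squares_edge : squares :=
  [:: (833900760, [:: 2; 1; 1; 0; -2; -1; -1; 1]);
      (283741920, [:: 1; 2; 2; 1; -3; 0; 0; -3]);
      (242550000, [:: 0; 2; 2; 2; -3; 0; 0; 2]);
      (81219600, [:: -2; 3; 3; 2; -3; -3; -3; 0]);
      (1152520380, [:: 0; 1; -1; 0; 0; 2; -2; 0])]%BZ.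
Definition squares_path : squares :=
  [:: (212697045, [:: 0; 3; -1; 0; -1; 0; -3; 0]);
      (73373850, [:: 1; -3; 0; -2; 0; -2; 3; -3]);
      (116830560, [:: 1; 0; -1; 2; -1; 2; -3; 0]);
      (153052350, [:: 1; 0; 2; 0; 2; 0; 0; -3]);
      (111456180, [:: 1; 1; 1; -1; 1; -1; -3; -1]);
      (207873765, [:: 2; -1; 0; 0; 0; 0; -3; -2])]%BZ.

Definition quad (L : squares) (c d : nat) : Z :=
  foldr (fun t acc => t.1 * nth Z0 t.2 c * nth Z0 t.2 d + acc) Z0 L.

Definition class (b0 b1 b2 : bool) : nat := (b0 + b1.*2 + b2.*2.*2)%N.

(** The pair of vertices 3 and 4 is never inspected. For fixed vertices 0, 1, 2 the coefficient
    therefore depends only on the two classes, and the sum over the last two vertices is a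
    combination of squares. *)
Definition qform (e : pattern) : Z :=
  let c := class (e 0%N 3%N) (e 1%N 3%N) (e 2%N 3%N) in
  let d := class (e 0%N 4%N) (e 1%N 4%N) (e 2%N 4%N) in
  match e 0%N 1%N, e 0%N 2%N, e 1%N 2%N with
  | false, false, false => quad squares_empty c d
  | true, false, false => quad squares_edge c d
  | true, true, false => quad squares_path c d
  | _, _, _ => Z0
  end.

Definition Zbool (b : bool) (z : Z) : Z := if b then z else Z0.

(** Divided by 1157587200, the constants are 5/18, 30 and 1/200. The factor 30 = 120/4 makes
    [P3K2_pattern] average over all labellings to the indicator of a copy; a further division by 30
    gives 1/108 and 1/6000. *)
Definition cert (e : pattern) : Z :=
  (321552000%BZ - Zbool (P3K2_pattern e) 34727616000%BZ)
  - Zbool (obstruction e) 5787936%BZ - qform e.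

Definition perms5 := permutations (iota 0 5).

Definition cert_sum (ps : seq (seq nat)) (e : pattern) : Z :=
  foldr (fun p acc => cert (relabel p e) + acc) Z0 ps.

Definition graph5 (b01 b02 b12 b03 b13 b23 b04 b14 b24 b34 : bool) : pattern :=
  fun i j => match i, j with
  | 0, 1 | 1, 0 => b01 | 0, 2 | 2, 0 => b02 | 1, 2 | 2, 1 => b12
  | 0, 3 | 3, 0 => b03 | 1, 3 | 3, 1 => b13 | 2, 3 | 3, 2 => b23
  | 0, 4 | 4, 0 => b04 | 1, 4 | 4, 1 => b14 | 2, 4 | 4, 2 => b24
  | 3, 4 | 4, 3 => b34 | _, _ => false
  end%N.

Definition all_bool (P : bool -> bool) : bool := P true && P false.

Definition all_graph5 (P : pattern -> bool) : bool :=
  all_bool (fun b01 => all_bool (fun b02 => all_bool (fun b12 =>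
  all_bool (fun b03 => all_bool (fun b13 => all_bool (fun b23 =>
  all_bool (fun b04 => all_bool (fun b14 => all_bool (fun b24 =>
  all_bool (fun b34 => P (graph5 b01 b02 b12 b03 b13 b23 b04 b14 b24 b34))))))))))).

Lemma cert_sum_ge0 :
  all_graph5 (fun e => BinInt.Z.leb Z0 (cert_sum perms5 e)).
Proof. by vm_compute. Qed.

Definition has_P3K2 e := has (fun p => P3K2_pattern (relabel p e)) perms5.

(** P3 + K2 has four automorphisms: flipping the path and flipping the edge. *)
Lemma count_P3K2 : all_graph5 (fun e =>
  count (fun p => P3K2_pattern (relabel p e)) perms5 == 4 * has_P3K2 e)%N.
Proof. by vm_compute. Qed.

End Certificate.

Lemma all_boolP (P : bool -> bool) : all_bool P -> forall b, P b.
Proof. by case/andP=> Pt Pf []. Qed.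

Lemma all_graph5P (P : pattern -> bool) : all_graph5 P ->
  forall b01 b02 b12 b03 b13 b23 b04 b14 b24 b34,
    P (graph5 b01 b02 b12 b03 b13 b23 b04 b14 b24 b34).
Proof.
move=> H b01 b02 b12 b03 b13 b23 b04 b14 b24 b34; move: H.
move=> /all_boolP/(_ b01)/all_boolP/(_ b02)/all_boolP/(_ b12)/all_boolP/(_ b03).
move=> /all_boolP/(_ b13)/all_boolP/(_ b23)/all_boolP/(_ b04)/all_boolP/(_ b14).
by move=> /all_boolP/(_ b24)/all_boolP/(_ b34).
Qed.

(** Patterns live on all of [nat], and those read off a graph through [inord] carry default values
    beyond the last index; only the first five indices are meaningful. *)
Definition eqpat5 (e e' : pattern) := forall i j, (i < 5)%N -> (j < 5)%N -> e i j = e' i j.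

Lemma eqpat5_graph5 (e : pattern) : (forall i j, e i j = e j i) -> (forall i, e i i = false) ->
  eqpat5 (graph5 (e 0 1) (e 0 2) (e 1 2) (e 0 3) (e 1 3) (e 2 3) (e 0 4) (e 1 4) (e 2 4) (e 3 4))%N e.
Proof.
move=> es ei [|[|[|[|[|i]]]]] // [|[|[|[|[|j]]]]] // _ _; rewrite /= ?ei //; exact: es.
Qed.

Lemma eqpat5_cert e e' : eqpat5 e e' -> cert e = cert e'.
Proof. by move=> H; rewrite /cert /P3K2_pattern /obstruction /qform !H. Qed.

Lemma eqpat5_P3K2 e e' : eqpat5 e e' -> P3K2_pattern e = P3K2_pattern e'.
Proof. by move=> H; rewrite /P3K2_pattern !H. Qed.

Lemma eqpat5_obstruction e e' : eqpat5 e e' -> obstruction e = obstruction e'.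
Proof. by move=> H; rewrite /obstruction !H. Qed.

Lemma nth_perms5 p i : p \in perms5 -> (i < 5)%N -> (nth 0 p i < 5)%N.
Proof.
rewrite mem_permutations => pp i5.
have : nth 0%N p i \in iota 0 5 by rewrite -(perm_mem pp) mem_nth // (perm_size pp) size_iota.
by rewrite mem_iota.
Qed.

Lemma eqpat5_relabel e e' p : p \in perms5 -> eqpat5 e e' -> eqpat5 (relabel p e) (relabel p e').
Proof. by move=> pp H i j i5 j5; rewrite /relabel H // nth_perms5. Qed.

Section Pat.
Variables (T : finType) (G : graph T).

Definition pat (k : nat) (f : {ffun 'I_k.+1 -> T}) : pattern :=
  fun i j => adj G (f (inord i)) (f (inord j)).

Lemma pat_sym k (f : {ffun 'I_k.+1 -> T}) i j : pat f i j = pat f j i.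
Proof. exact: adj_sym. Qed.

Lemma pat_irr k (f : {ffun 'I_k.+1 -> T}) i : pat f i i = false.
Proof. exact: adj_irrefl. Qed.

Definition fcomp (k : nat) (f : {ffun 'I_k.+1 -> T}) (p : seq nat) : {ffun 'I_5 -> T} :=
  [ffun i : 'I_5 => f (inord (nth 0%N p i))].

Lemma pat_fcomp k (f : {ffun 'I_k.+1 -> T}) p : eqpat5 (pat (fcomp f p)) (relabel p (pat f)).
Proof. by move=> i j i5 j5; rewrite /pat /fcomp !ffunE !inordK. Qed.

End Pat.

Lemma all_graph5_pat (T : finType) (G : graph T) (P : pattern -> bool) (f : {ffun 'I_5 -> T}) :
  (forall e e', eqpat5 e e' -> P e = P e') -> all_graph5 P -> P (pat G f).
Proof.
move=> Pext /all_graph5P PT.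
rewrite -(Pext _ _ (eqpat5_graph5 (pat_sym G f) (pat_irr G f))); exact: PT.
Qed.

Lemma inord_perms5_inj p : p \in perms5 -> injective (fun i : 'I_5 => inord (nth 0%N p i) : 'I_5).
Proof.
move=> pp i j /(congr1 val) /=; rewrite !inordK ?nth_perms5 // => /eqP.
move: pp; rewrite mem_permutations => pp.
rewrite nth_uniq ?(perm_size pp) ?size_iota //; last by rewrite (perm_uniq pp) iota_uniq.
by move/eqP/val_inj.
Qed.

Lemma fcomp_bij (T : finType) p : p \in perms5 -> bijective (fun f : {ffun 'I_5 -> T} => fcomp f p).
Proof.
move=> pp; apply: injF_bij => f g /ffunP fg; apply/ffunP => i.
have [s' _ sK] : bijective (fun i : 'I_5 => inord (nth 0%N p i) : 'I_5).
  exact/injF_bij/inord_perms5_inj.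
by have := fg (s' i); rewrite !ffunE sK.
Qed.

(** * Weighted sums over five-tuples *)

Section WeightedSums.
Variable R : realFieldType.
(** Locked, so that the large constants of the certificate stay symbolic in [R]. *)
Definition zr (z : BinNums.Z) : R := locked (fun z => (int_of_Z z)%:~R : R) z.
Lemma zrE z : zr z = (int_of_Z z)%:~R.
Proof. by rewrite /zr -lock. Qed.

Lemma zrD a b : zr (BinInt.Z.add a b) = zr a + zr b.
Proof. by rewrite !zrE (rmorphD int_of_Z) intrD. Qed.

Lemma zrM a b : zr (BinInt.Z.mul a b) = zr a * zr b.
Proof. by rewrite !zrE (rmorphM int_of_Z) intrM. Qed.

Lemma zrB a b : zr (BinInt.Z.sub a b) = zr a - zr b.
Proof. by rewrite !zrE (rmorphB int_of_Z) intrB. Qed.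

Lemma zr0 : zr BinNums.Z0 = 0. Proof. by rewrite zrE. Qed.

Lemma zr_ge0 a : BinInt.Z.leb BinNums.Z0 a -> 0 <= zr a.
Proof. by case: a => [|p|p] //; rewrite ?zr0 // zrE ler0z. Qed.

Lemma zr_Zbool b z : zr (Zbool b z) = b%:R * zr z.
Proof. by case: b; rewrite ?mul1r ?mul0r ?zr0. Qed.

Definition psum (T : finType) (G : graph T) (w : T -> R) (phi : pattern -> R) : R :=
  \sum_(f : {ffun 'I_5 -> T}) (\prod_i w (f i)) * phi (pat G f).

Lemma prod_fcomp (T : finType) (w : T -> R) p (f : {ffun 'I_5 -> T}) : p \in perms5 ->
  \prod_i w (fcomp f p i) = \prod_i w (f i).
Proof.
move=> pp; rewrite [RHS](reindex_inj (inord_perms5_inj pp)) /=.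
by apply: eq_bigr => i _; rewrite ffunE.
Qed.

Lemma psum_relabel (T : finType) (G : graph T) (w : T -> R) (phi : pattern -> R) p :
  p \in perms5 -> (forall e e', eqpat5 e e' -> phi e = phi e') ->
  psum G w (fun e => phi (relabel p e)) = psum G w phi.
Proof.
move=> pp Pext; rewrite /psum [RHS](reindex (fun f : {ffun 'I_5 -> T} => fcomp f p)); last first.
  by case: (fcomp_bij T pp) => g gK fK; exists g => x _; [apply: gK | apply: fK].
by apply: eq_bigr => f _; rewrite prod_fcomp // -(Pext _ _ (pat_fcomp G f p)).
Qed.

Lemma psumD (T : finType) (G : graph T) (w : T -> R) phi psi :
  psum G w (fun e => phi e + psi e) = psum G w phi + psum G w psi.
Proof. by rewrite /psum -big_split; apply: eq_bigr => f _; rewrite mulrDr. Qed.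

Lemma psumZ (T : finType) (G : graph T) (w : T -> R) c phi :
  psum G w (fun e => c * phi e) = c * psum G w phi.
Proof. by rewrite /psum big_distrr; apply: eq_bigr => f _; rewrite mulrCA. Qed.

Lemma psum1 (T : finType) (G : graph T) (w : T -> R) :
  psum G w (fun=> 1) = (\sum_x w x) ^+ 5.
Proof.
rewrite /psum -[5%N in RHS]card_ord -prodr_const bigA_distr_bigA /=.
by apply: eq_bigr => f _; rewrite mulr1.
Qed.

(** Permuting coordinates preserves the weight of a tuple, so [cert] may be replaced by its sum over
    all 120 relabellings. A tuple with repetitions still spans a graph, with equal vertices as
    non-adjacent twins, so the check of all graphs on five vertices covers every tuple. *)
Lemma psum_cert_ge0 (T : finType) (G : graph T) (w : T -> R) :
  (forall x, 0 <= w x) -> 0 <= psum G w (fun e => zr (cert e)).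
Proof.
move=> w0.
have H (ps : seq (seq nat)) : {subset ps <= perms5} ->
    psum G w (fun e => zr (cert_sum ps e)) = (size ps)%:R * psum G w (fun e => zr (cert e)).
  elim: ps => [|p ps IH] sp.
    by rewrite mul0r /psum big1 // => f _; rewrite zr0 mulr0.
  transitivity (psum G w (fun e => zr (cert (relabel p e)) + zr (cert_sum ps e))).
    by apply: eq_bigr => f _; rewrite -zrD.
  rewrite psumD IH; last by move=> q qp; apply: sp; rewrite inE qp orbT.
  rewrite (@psum_relabel _ _ _ (fun e => zr (cert e))) ?sp ?mem_head //; last first.
    by move=> e e' /eqpat5_cert ->.
  by rewrite [size (_ :: _)]/= -natr1 mulrDl mul1r addrC.
have := H _ (fun _ => id).
have -> : size perms5 = 120%N by vm_compute.
move=> E; suff: 0 <= 120%:R * psum G w (fun e => zr (cert e)) by rewrite pmulr_rge0.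
rewrite -E; apply: sumr_ge0 => f _; apply: mulr_ge0; first exact: prodr_ge0.
apply: zr_ge0; move: cert_sum_ge0; apply: (@all_graph5_pat T G (fun e => BinInt.Z.leb BinNums.Z0 (cert_sum perms5 e)) f).
move=> e e' ee'; congr (BinInt.Z.leb _ _).
have: {subset perms5 <= perms5} by [].
rewrite /cert_sum; elim: {1 3 4}perms5 => //= p ps IH sp.
rewrite IH; first by rewrite (eqpat5_cert (eqpat5_relabel (sp _ (mem_head _ _)) ee')).
by move=> q qp; rewrite sp // inE qp orbT.
Qed.

Definition tup5 (T : Type) (a b c d e : T) : {ffun 'I_5 -> T} :=
  [ffun i : 'I_5 => nth a [:: a; b; c; d; e] i].

Lemma sum_tup5 (V : nmodType) (T : finType) (h : {ffun 'I_5 -> T} -> V) :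
  \sum_f h f = \sum_a \sum_b \sum_c \sum_d \sum_e h (tup5 a b c d e).
Proof.
rewrite !pair_bigA /=.
transitivity (\sum_(p : T * T * T * T * T) h (tup5 p.1.1.1.1 p.1.1.1.2 p.1.1.2 p.1.2 p.2)); last first.
  by [].
apply: reindex; exists (fun f : {ffun 'I_5 -> T} => (f (inord 0), f (inord 1), f (inord 2), f (inord 3), f (inord 4))).
  by move=> [[[[a b] c] d] e] _; rewrite /tup5 !ffunE !inordK.
move=> f _; apply/ffunP => i; rewrite ffunE.
by case: i => [[|[|[|[|[|i]]]]] i5] //=; congr (f _); apply: val_inj; rewrite /= inordK.
Qed.

Lemma pat_tup5 (T : finType) (G : graph T) (a b c d e : T) i j : (i < 5)%N -> (j < 5)%N ->
  pat G (tup5 a b c d e) i j = adj G (nth a [:: a; b; c; d; e] i) (nth a [:: a; b; c; d; e] j).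
Proof. by move=> i5 j5; rewrite /pat !ffunE !inordK. Qed.

Lemma prod_tup5 (T : finType) (w : T -> R) (a b c d e : T) :
  \prod_i w (tup5 a b c d e i) = w a * w b * w c * w d * w e.
Proof. by rewrite !big_ord_recl big_ord0 !ffunE /= mulr1 !mulrA. Qed.

Lemma quad_ge0 (L : squares) (T : finType) (w : T -> R) (cl : T -> nat) :
  all (fun t => BinInt.Z.leb BinNums.Z0 t.1) L ->
  0 <= \sum_d \sum_e w d * w e * zr (quad L (cl d) (cl e)).
Proof.
elim: L => [|t L IH] /=.
  by move=> _; apply: sumr_ge0 => d _; apply: sumr_ge0 => e _; rewrite zr0 mulr0.
case/andP=> t0 /IH{}IH.
rewrite (_ : \sum_d _ = zr t.1 * (\sum_d w d * zr (nth BinNums.Z0 t.2 (cl d))) ^+ 2 +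
  \sum_d \sum_e w d * w e * zr (quad L (cl d) (cl e))).
  by rewrite addr_ge0 // mulr_ge0 ?sqr_ge0 ?zr_ge0.
rewrite expr2 big_distrlr /= mulr_sumr -big_split; apply: eq_bigr => d _.
rewrite mulr_sumr -big_split; apply: eq_bigr => e _.
rewrite zrD !zrM /=; ring.
Qed.

End WeightedSums.

Lemma zr_eqM (R : realFieldType) a b c : BinInt.Z.eqb a (BinInt.Z.mul b c) -> zr R a = zr R b * zr R c.
Proof. by move/BinInt.Z.eqb_eq ->; rewrite zrM. Qed.

#[local] Arguments quad : simpl never.
Section Cert.
Variables (R : realFieldType) (T : finType) (G : graph T) (w : T -> R).
Hypothesis w_ge0 : forall x, 0 <= w x.

Lemma psum_qform_ge0 : 0 <= psum G w (fun e => zr R (qform e)).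
Proof.
rewrite /psum sum_tup5.
apply: sumr_ge0 => a _; apply: sumr_ge0 => b _; apply: sumr_ge0 => c _.
rewrite (_ : \sum_d _ = w a * w b * w c * \sum_d \sum_e w d * w e *
   zr R (qform (pat G (tup5 a b c d e)))); last first.
  rewrite mulr_sumr; apply: eq_bigr => d _; rewrite mulr_sumr; apply: eq_bigr => e _.
  by rewrite prod_tup5 !mulrA.
apply: mulr_ge0; first by rewrite !mulr_ge0.
pose cl x := class (adj G a x) (adj G b x) (adj G c x).
under eq_bigr => d _ do under eq_bigr => e _ do
  rewrite /qform !pat_tup5 //= -/(cl d) -/(cl e).
case: (adj G a b); case: (adj G a c); case: (adj G b c);
  try (by apply: sumr_ge0 => d _; apply: sumr_ge0 => e _; rewrite zr0 mulr0);
  by apply: (@quad_ge0 R _ T w cl); vm_compute.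
Qed.

Lemma flag_inequality :
  psum G w (fun e => (P3K2_pattern e)%:R) <=
    (\sum_x w x) ^+ 5 / 108 - psum G w (fun e => (obstruction e)%:R) / 6000.
Proof.
have := psum_cert_ge0 G w_ge0; have := psum_qform_ge0.
rewrite (_ : psum G w (fun e => zr R (cert e)) =
  zr R (321552000%BZ) * (\sum_x w x) ^+ 5
  - zr R (34727616000%BZ) * psum G w (fun e => (P3K2_pattern e)%:R)
  - zr R (5787936%BZ) * psum G w (fun e => (obstruction e)%:R)
  - psum G w (fun e => zr R (qform e))); last first.
  rewrite -(psum1 G) -!psumZ -!sumrB; apply: eq_bigr => f _.
  rewrite /cert !zrB !zr_Zbool; ring.
(* Only the ratios 108 and 6000 matter: they are verified in [Z], and the common factor is kept
   abstract and cancelled. *)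
have E1 : zr R 34727616000%BZ = zr R 321552000%BZ * zr R 108%BZ.
  exact: zr_eqM.
have E2 : zr R 34727616000%BZ = zr R 5787936%BZ * zr R 6000%BZ.
  exact: zr_eqM.
have E3 : zr R 6000%BZ = zr R 60%BZ * zr R 100%BZ.
  exact: zr_eqM.
have E4 : zr R 60%BZ = 60 by rewrite zrE.
have E5 : zr R 100%BZ = 100 by rewrite zrE.
have E6 : zr R 108%BZ = 108 by rewrite zrE.
rewrite E3 E4 E5 E1 E6 in E2; rewrite E1 E6 {E1 E3 E4 E5 E6}.
have c0 : 0 < zr R 321552000%BZ.
  by rewrite lt_neqAle zr_ge0 // eq_sym zrE intr_eq0.
have -> : zr R 5787936%BZ = zr R 321552000%BZ * (108 / 6000).
  lra.
set c := zr R _ in c0 *; set W := _ ^+ 5; set q := psum _ _ _; set M := psum _ _ _; set B := psum _ _ _.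
move=> q0 H; rewrite -(ler_pM2l c0).
have : 0 <= c * W - c * 108 * M - c * (108 / 6000) * B by lra.
lra.
Qed.

End Cert.

(** * Frames and misplaced pairs *)

Definition K3K3_adj (i j : nat) : bool := (i != j) && ((i < 3)%N == (j < 3)%N).

Lemma adj_K3K3 (i j : 'I_6) : adj K3K3 i j = K3K3_adj i j.
Proof.
rewrite /K3K3 adj_graph_of /K3K3_adj -(inj_eq val_inj) /=.
case: (@splitP 3 3 i) => i' ->; case: (@splitP 3 3 j) => j' ->.
- rewrite !adj_graph_of -!(inj_eq val_inj) /=.
  by case: eqVneq => //= _; case: eqVneq.
- by rewrite andbF.
- by rewrite andbF.
- rewrite !adj_graph_of -!(inj_eq val_inj) /= eqn_add2l.
  by case: eqVneq => //= _; case: eqVneq.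
Qed.

(* The part of a vertex in K3K3, read off from its adjacencies to an induced
   copy of 2K2 placed in the parts 0, 1, 3 and 4; the value 0 is junk when no
   part is compatible. *)
Definition frame_part (b0 b1 b2 b3 : bool) : nat :=
  match b0, b1, b2, b3 with
  | false, true, false, false => 0
  | true, false, false, false => 1
  | true, true, false, false => 2
  | false, false, false, true => 3
  | false, false, true, false => 4
  | false, false, true, true => 5
  | _, _, _, _ => 0
  end%N.

(** Vertices 0 to 3 form the 2K2, and 4, 5 are the pair under test. The sixth entry is the omitted
    vertex; it makes each list a permutation, so that every five-tuple arises from exactly [#|T|]
    six-tuples. These lists need not detect every obstruction, only one for each misplaced pair. *)
Definition frame_tuples : seq (seq nat) :=
  [:: [:: 0; 4; 2; 3; 5; 1]; [:: 0; 5; 2; 3; 4; 1]; [:: 0; 1; 4; 5; 2; 3]; [:: 3; 5; 1; 0; 4; 2];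
      [:: 3; 4; 0; 1; 5; 2]; [:: 4; 5; 1; 0; 3; 2]; [:: 0; 5; 3; 2; 1; 4]; [:: 4; 5; 2; 3; 1; 0];
      [:: 4; 1; 0; 5; 2; 3]; [:: 0; 1; 5; 2; 4; 3]; [:: 1; 0; 5; 4; 2; 3]; [:: 0; 4; 5; 3; 1; 2];
      [:: 0; 1; 2; 3; 5; 4]; [:: 0; 1; 2; 4; 5; 3]; [:: 1; 4; 2; 3; 5; 0]; [:: 1; 5; 2; 3; 4; 0]]%N.

Definition framed (u0 u1 u2 u3 v0 v1 v2 v3 uv : bool) : pattern :=
  fun i j => match i, j with
  | 0, 1 | 1, 0 | 2, 3 | 3, 2 => true
  | 0, 4 | 4, 0 => u0 | 1, 4 | 4, 1 => u1 | 2, 4 | 4, 2 => u2 | 3, 4 | 4, 3 => u3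
  | 0, 5 | 5, 0 => v0 | 1, 5 | 5, 1 => v1 | 2, 5 | 5, 2 => v2 | 3, 5 | 5, 3 => v3
  | 4, 5 | 5, 4 => uv | _, _ => false
  end%N.

Lemma framed_obstruction u0 u1 u2 u3 v0 v1 v2 v3 uv :
  uv != K3K3_adj (frame_part u0 u1 u2 u3) (frame_part v0 v1 v2 v3) ->
  has (fun t => obstruction (relabel t (framed u0 u1 u2 u3 v0 v1 v2 v3 uv))) frame_tuples.
Proof.
by case: u0; case: u1; case: u2; case: u3; case: v0; case: v1; case: v2; case: v3; case: uv.
Qed.

Lemma frame_tuples_perm : all (fun t => perm_eq t (iota 0 6)) frame_tuples.
Proof. by []. Qed.

Lemma sum_fcomp6 (V : nmodType) (T : finType) (h : {ffun 'I_5 -> T} -> V) t :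
  perm_eq t (iota 0 6) ->
  \sum_(g : {ffun 'I_6 -> T}) h (fcomp g t) = (\sum_f h f) *+ #|T|.
Proof.
move=> pt.
have st : size t = 6%N by rewrite (perm_size pt) size_iota.
have ut : uniq t by rewrite (perm_uniq pt) iota_uniq.
have tE i : (i \in t) = (i < 6)%N by rewrite (perm_mem pt) mem_iota.
have tlt i : (i < 6)%N -> (nth 0 t i < 6)%N by move=> i6; rewrite -tE mem_nth ?st.
rewrite (reindex (fun p : {ffun 'I_5 -> T} * T =>
   [ffun i : 'I_6 => if (index (i : nat) t < 5)%N then p.1 (inord (index (i : nat) t)) else p.2])) /=.
  rewrite -sumr_const exchange_big /= pair_bigA; apply: eq_bigr => -[f x] _; congr h.
  apply/ffunP => i; have i5 := ltn_ord i; have i6 := ltnW i5.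
  by rewrite !ffunE inordK ?tlt // index_uniq ?st // i5 inord_val.
exists (fun g => (fcomp g t, g (inord (nth 0%N t 5)))) => [[f x]|g] _.
  congr (_, _); last by rewrite ffunE inordK ?tlt // index_uniq ?st.
  apply/ffunP => i; have i5 := ltn_ord i; have i6 := ltnW i5.
  by rewrite !ffunE inordK ?tlt // index_uniq ?st // i5 inord_val.
apply/ffunP => i; rewrite ffunE /=.
have it : (i : nat) \in t by rewrite tE.
have := it; rewrite -index_mem st ltnS leq_eqVlt; case: ifP => [i5 _|_].
  by rewrite ffunE inordK // nth_index // inord_val.
rewrite orbF => /eqP i5.
by rewrite (_ : nth 0%N t 5 = i) ?inord_val // -[RHS](nth_index 0%N it); congr nth.
Qed.

Definition tup6 (T : Type) (a b c d e f : T) : {ffun 'I_6 -> T} :=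
  [ffun i : 'I_6 => nth a [:: a; b; c; d; e; f] i].

Lemma sum_tup6 (V : nmodType) (T : finType) (h : {ffun 'I_6 -> T} -> V) :
  \sum_g h g = \sum_a \sum_b \sum_c \sum_d \sum_e \sum_f h (tup6 a b c d e f).
Proof.
rewrite !pair_bigA /=.
transitivity (\sum_(p : T * T * T * T * T * T)
    h (tup6 p.1.1.1.1.1 p.1.1.1.1.2 p.1.1.1.2 p.1.1.2 p.1.2 p.2)); last by [].
apply: reindex; exists (fun f : {ffun 'I_6 -> T} =>
    (f (inord 0), f (inord 1), f (inord 2), f (inord 3), f (inord 4), f (inord 5))).
  by move=> [[[[[a b] c] d] e] g] _; rewrite /tup6 !ffunE !inordK.
move=> f _; apply/ffunP => i; rewrite ffunE.
by case: i => [[|[|[|[|[|[|i]]]]]] i6] //=; congr (f _); apply: val_inj; rewrite /= inordK.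
Qed.

Lemma pat_tup6 (T : finType) (G : graph T) (a b c d e f : T) i j : (i < 6)%N -> (j < 6)%N ->
  pat G (tup6 a b c d e f) i j =
  adj G (nth a [:: a; b; c; d; e; f] i) (nth a [:: a; b; c; d; e; f] j).
Proof. by move=> i6 j6; rewrite /pat !ffunE !inordK. Qed.

Section Frame.
Variables (R : realFieldType) (T : finType) (G : graph T).

Definition count_pattern (P : pattern -> bool) : R := psum G (fun=> 1) (fun e => (P e)%:R).

Lemma count_patternE P : count_pattern P = \sum_(f : {ffun 'I_5 -> T}) (P (pat G f))%:R.
Proof. by apply: eq_bigr => f _; rewrite big1 // mul1r. Qed.

Definition misplaced (c : T -> 'I_6) : R :=
  \sum_u \sum_v (adj G u v != adj K3K3 (c u) (c v))%:R.

Definition two_edges (x y z t : T) : bool :=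
  [&& adj G x y, adj G z t, ~~ adj G x z, ~~ adj G x t, ~~ adj G y z & ~~ adj G y t].

Definition part_of (x y z t u : T) : 'I_6 :=
  inord (frame_part (adj G x u) (adj G y u) (adj G z u) (adj G t u)).

Lemma part_ofE x y z t u :
  part_of x y z t u = frame_part (adj G x u) (adj G y u) (adj G z u) (adj G t u) :> nat.
Proof. by rewrite inordK // /frame_part; do ! case: adj. Qed.

Lemma framed_tup6 x y z t u v : two_edges x y z t -> forall i j, (i < 6)%N -> (j < 6)%N ->
  pat G (tup6 x y z t u v) i j =
  framed (adj G x u) (adj G y u) (adj G z u) (adj G t u)
         (adj G x v) (adj G y v) (adj G z v) (adj G t v) (adj G u v) i j.
Proof.
case/and5P=> xy zt /negbTE xz /negbTE xt /andP[/negbTE yz /negbTE yt] i j i6 j6.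
rewrite pat_tup6 //; move: i j i6 j6.
by do 6 (case=> [|i]; [by do 6 (case=> [|j]; [by rewrite /= ?adj_irrefl // ?xy ?zt ?xz ?xt ?yz ?yt // adj_sym ?xy ?zt ?xz ?xt ?yz ?yt | move: j]) | move: i]).
Qed.

Lemma misplaced_le_obstructions x y z t : two_edges x y z t ->
  misplaced (part_of x y z t) <=
  \sum_u \sum_v \sum_(p <- frame_tuples) (obstruction (pat G (fcomp (tup6 x y z t u v) p)))%:R.
Proof.
move=> F; apply: ler_sum => u _; apply: ler_sum => v _.
case: (boolP (_ != _)) => [H|_]; last exact: sumr_ge0.
move: H; rewrite adj_K3K3 !part_ofE => /framed_obstruction /hasP[p pF O].
suff O' : obstruction (pat G (fcomp (tup6 x y z t u v) p)).
  by rewrite (big_rem p) //= O' lerDl sumr_ge0.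
rewrite (eqpat5_obstruction (pat_fcomp G _ _)); apply: etrans O.
apply: eqpat5_obstruction => i j i5 j5; rewrite /relabel framed_tup6 //.
  have /allP/(_ _ pF) pp := frame_tuples_perm.
  have : nth 0%N p i \in iota 0 6 by rewrite -(perm_mem pp) mem_nth // (perm_size pp) size_iota ltnW.
  by rewrite mem_iota.
have /allP/(_ _ pF) pp := frame_tuples_perm.
have : nth 0%N p j \in iota 0 6 by rewrite -(perm_mem pp) mem_nth // (perm_size pp) size_iota ltnW.
by rewrite mem_iota.
Qed.

(** Every ordered 2K2 defines a placement and so contributes at least [m]. Each misplaced pair is
    charged to one of the 16 lists, and each list sees every five-tuple [#|T|] times. *)
Lemma misplaced_count (m : R) : (forall c, m <= misplaced c) ->
  m * (\sum_x \sum_y \sum_z \sum_t (two_edges x y z t)%:R) <=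
  16 * #|T|%:R * count_pattern obstruction.
Proof.
move=> mc.
rewrite (_ : 16 * _ * _ = \sum_(g : {ffun 'I_6 -> T}) \sum_(p <- frame_tuples)
    (obstruction (pat G (fcomp g p)))%:R); last first.
  rewrite exchange_big /= (eq_big_seq (fun=> count_pattern obstruction *+ #|T|)).
    by rewrite big_const_seq count_predT /= -mulr_natl; ring.
  by move=> p pF; rewrite count_patternE -(sum_fcomp6 _ (allP frame_tuples_perm _ pF)).
rewrite sum_tup6 mulr_sumr; apply: ler_sum => x _; rewrite mulr_sumr; apply: ler_sum => y _.
rewrite mulr_sumr; apply: ler_sum => z _; rewrite mulr_sumr; apply: ler_sum => t _.
case: (boolP (two_edges x y z t)) => [F|_]; last first.
  by rewrite mulr0; do 3 (apply: sumr_ge0 => ? _).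
rewrite mulr1; apply: le_trans (mc _) _; exact: misplaced_le_obstructions.
Qed.

(** Deleting an end of the path leaves an induced 2K2. Hence a nearly extremal graph has of order
    [n^4] of them to average over. *)
Lemma count_P3K2_two_edges : count_pattern P3K2_pattern <=
  #|T|%:R * (\sum_x \sum_y \sum_z \sum_t (two_edges x y z t)%:R).
Proof.
rewrite count_patternE sum_tup5.
rewrite (_ : _ * _ = \sum_x \sum_y \sum_(u : T) \sum_z \sum_t (two_edges x y z t)%:R); last first.
  rewrite mulr_sumr; apply: eq_bigr => x _; rewrite mulr_sumr.
  by apply: eq_bigr => y _; rewrite sumr_const mulr_natl.
do 5 (apply: ler_sum => ? _); rewrite /P3K2_pattern !pat_tup5 //= ler_nat /two_edges.
by do ! [case: (adj G _ _) => //=].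
Qed.

End Frame.

(** * Densities in blow-ups of K3K3 *)

Lemma sum_inord6 (V : nmodType) (F : 'I_6 -> V) : \sum_i F i =
  F (inord 0) + F (inord 1) + F (inord 2) + (F (inord 3) + F (inord 4) + F (inord 5)).
Proof.
rewrite !big_ord_recl big_ord0 addr0 !addrA.
by do ! congr (_ + _); congr F; apply: val_inj; rewrite /= inordK.
Qed.

Section Optimum.
Variable R : realFieldType.
Implicit Types a b c d e f s t : R.

(** In a blow-up of a triangle with part weights [a], [b], [c], [cherry3] and [edge3] weigh the
    labelled induced P3 and K2, the two ends of the path being allowed to coincide. [spread3]
    measures how far the parts are from equal. *)
Definition cherry3 a b c := a ^+ 2 * (b + c) + b ^+ 2 * (a + c) + c ^+ 2 * (a + b).
Definition edge3 a b c := 2 * (a * b + b * c + c * a).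
Definition spread3 a b c := a ^+ 2 + b ^+ 2 + c ^+ 2 - a * b - b * c - c * a.

Lemma spread3_ge0 a b c : 0 <= spread3 a b c.
Proof.
have -> : spread3 a b c = ((a - b) ^+ 2 + (b - c) ^+ 2 + (c - a) ^+ 2) / 2 by rewrite /spread3; field.
by rewrite divr_ge0 // !addr_ge0 ?sqr_ge0.
Qed.

Lemma schur_sorted a b c : 0 <= c -> c <= b -> b <= a ->
  0 <= a * (a - b) * (a - c) + b * (b - a) * (b - c) + c * (c - a) * (c - b).
Proof.
move=> c0 cb ba.
have -> : a * (a - b) * (a - c) + b * (b - a) * (b - c) + c * (c - a) * (c - b) =
  (a - b) ^+ 2 * (a + b - c) + c * ((a - c) * (b - c)) by ring.
by rewrite addr_ge0 // mulr_ge0 ?sqr_ge0 // ?mulr_ge0 //; lra.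
Qed.

Lemma schur a b c : 0 <= a -> 0 <= b -> 0 <= c ->
  0 <= a * (a - b) * (a - c) + b * (b - a) * (b - c) + c * (c - a) * (c - b).
Proof.
move=> a0 b0 c0.
have [ab|/ltW ab] := leP a b; have [bc|/ltW bc] := leP b c; have [ac|/ltW ac] := leP a c.
- have := schur_sorted a0 ab bc; lra.
- have := schur_sorted a0 ab bc; lra.
- have := schur_sorted a0 ac bc; lra.
- have := schur_sorted c0 ac ab; lra.
- have := schur_sorted b0 ab ac; lra.
- have := schur_sorted b0 bc ac; lra.
- have := schur_sorted c0 bc ab; lra.
- have := schur_sorted c0 bc ab; lra.
Qed.

(** The difference of the two sides is three times the expression in Schur's inequality. *)
Lemma cherry3_le a b c : 0 <= a -> 0 <= b -> 0 <= c ->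
  9 * cherry3 a b c <= (a + b + c) * (2 * (a + b + c) ^+ 2 + spread3 a b c).
Proof.
by move=> a0 b0 c0; have := schur a0 b0 c0; rewrite /cherry3 /spread3; lra.
Qed.

Lemma edge3E a b c : 3 * edge3 a b c = 2 * ((a + b + c) ^+ 2 - spread3 a b c).
Proof. by rewrite /edge3 /spread3; ring. Qed.

(** Here [s], [t] are the weights of the two triangles and [D], [D'] their spreads; the optimum 1/8
    is at [s = t = 1/2], [D = D' = 0]. The obstacle is that [D] has coefficient [t^2 (s - 2t)],
    positive for [s > 2/3]: an uneven heavy side then helps. *)
Lemma balance_half s t D D' eps : s + t = 1 -> t <= s -> 0 <= t ->
  0 <= D -> D <= s ^+ 2 -> 0 <= D' -> D' <= t ^+ 2 -> eps < 1 / 288 ->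
  1 / 8 - eps <= s * (2 * s ^+ 2 + D) * (t ^+ 2 - D') + t * (2 * t ^+ 2 + D') * (s ^+ 2 - D) ->
  [/\ (s - 1 / 2) ^+ 2 <= 2 * eps, D <= 25 * eps & D' <= 25 * eps].
Proof.
move=> st ts t0 D0 Ds D'0 D't eps288.
set Q := (X in _ <= X).
have QE : Q = 2 * (s * t) ^+ 2 + D * (t ^+ 2 * (s - 2 * t)) - D' * (s ^+ 2 * (2 * s - t)) - D * D'.
  by rewrite /Q (_ : s = 1 - t); [ring | lra].
have DD : 0 <= D * D' by rewrite mulr_ge0.
have tE : t = 1 - s by lra.
have s12 : 1 / 2 <= s by lra.
have s1 : s <= 1 by lra.
have s2 : 1 / 4 <= s ^+ 2 by rewrite expr2; nra.
have D'8 : D' / 8 <= D' * (s ^+ 2 * (2 * s - t)).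
  by apply: ler_wpM2l => //; nra.
pose u := s - 1 / 2.
have st2 : 2 * (s * t) ^+ 2 <= 1 / 8 - u ^+ 2 / 2.
  have -> : s * t = 1 / 4 - u ^+ 2 by rewrite tE /u; field.
  have : 0 <= u ^+ 2 <= 1 / 4.
    by rewrite sqr_ge0 /= /u expr2; nra.
  by set v := u ^+ 2; case/andP=> v0 v4; nra.
(* Up to 1/12 both spreads have coefficients negative and bounded away from 0. Between 1/12 and 1/6
   the loss [u^2/2] already exceeds [1/288 = (1/12)^2/2]. Beyond 1/6 the bound [D <= s^2] leaves at
   most [3 * 4/27 * 2/9 = 8/81], too far below 1/8. *)
have [u12|u12] := leP u (1 / 12).
  have t2 : 25 / 144 <= t ^+ 2 by rewrite expr2 tE; rewrite /u in u12; nra.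
  have DD2 : D * (t ^+ 2 * (s - 2 * t)) <= - (25 / 576) * D.
    rewrite [_ * D]mulrC; apply: ler_wpM2l => //.
    have : s - 2 * t <= - (1 / 4) by rewrite tE; rewrite /u in u12; lra.
    nra.
  have u0 := sqr_ge0 u.
  move=> H; rewrite QE in H; rewrite -/u; split; lra.
have [u6|u6] := leP u (1 / 6).
  have DD2 : D * (t ^+ 2 * (s - 2 * t)) <= 0.
    rewrite mulr_ge0_le0 // mulr_ge0_le0 ?sqr_ge0 // tE; rewrite /u in u6; lra.
  have u0 : 1 / 144 < u ^+ 2 by rewrite expr2; nra.
  move=> H; rewrite QE in H; exfalso; lra.
have DD2 : D * (t ^+ 2 * (s - 2 * t)) <= s ^+ 2 * (t ^+ 2 * (s - 2 * t)).
  apply: ler_wpM2r => //; rewrite mulr_ge0 ?sqr_ge0 // tE; rewrite /u in u6; lra.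
have Q3 : 2 * (s * t) ^+ 2 + s ^+ 2 * (t ^+ 2 * (s - 2 * t)) = 3 * ((s ^+ 2 * t) * (s * t)).
  by rewrite tE; ring.
have st9 : s * t <= 2 / 9 by rewrite tE; rewrite /u in u6; nra.
have sst : s ^+ 2 * t <= 4 / 27.
  have : 0 <= (s - 2 / 3) ^+ 2 * (s + 1 / 3) by rewrite mulr_ge0 ?sqr_ge0 //; lra.
  rewrite tE; lra.
have st0 : 0 <= s * t by rewrite mulr_ge0 //; lra.
have : (s ^+ 2 * t) * (s * t) <= 4 / 27 * (2 / 9).
  by apply: ler_pM => //; rewrite mulr_ge0 ?sqr_ge0.
move=> H3 H; rewrite QE in H; exfalso; lra.
Qed.

Definition K3K3_poly a b c d e f :=
  cherry3 a b c * edge3 d e f + cherry3 d e f * edge3 a b c.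

(** The factor 27/2 is the 9 of [cherry3_le] times 3/2 from [edge3E]; it turns 1/108 into 1/8 and
    [2/27 eps] into [eps]. *)
Lemma K3K3_poly_le a b c d e f :
  0 <= a -> 0 <= b -> 0 <= c -> 0 <= d -> 0 <= e -> 0 <= f ->
  let s := a + b + c in let t := d + e + f in
  let D := spread3 a b c in let D' := spread3 d e f in
  27 / 2 * K3K3_poly a b c d e f <=
    s * (2 * s ^+ 2 + D) * (t ^+ 2 - D') + t * (2 * t ^+ 2 + D') * (s ^+ 2 - D).
Proof.
move=> a0 b0 c0 d0 e0 f0; set s := a + b + c; set t := d + e + f.
set D := spread3 a b c; set D' := spread3 d e f; cbv zeta.
have E0 x y z : 0 <= x -> 0 <= y -> 0 <= z -> 0 <= edge3 x y z.
  by move=> x0 y0 z0; rewrite mulr_ge0 // !addr_ge0 ?mulr_ge0.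
have := ler_wpM2r (E0 _ _ _ d0 e0 f0) (cherry3_le a0 b0 c0).
have := ler_wpM2r (E0 _ _ _ a0 b0 c0) (cherry3_le d0 e0 f0).
rewrite /K3K3_poly -/s -/t -/D -/D'.
have := edge3E a b c; rewrite -/s -/D => e1; have := edge3E d e f; rewrite -/t -/D' => e2.
clearbody s t D D'.
have -> : s ^+ 2 - D = 3 / 2 * edge3 a b c by lra.
have -> : t ^+ 2 - D' = 3 / 2 * edge3 d e f by lra.
lra.
Qed.

(** Three times [a - 1/6] is [(2a - b - c) + (s - 1/2)], and [(2a - b - c)^2] is at most four times
    the spread. So the square is at most [(8 * 25 + 2 * 2)/9 * eps], below [25 * eps]. *)
Lemma third_dev a b c s eps : a + b + c = s -> (s - 1 / 2) ^+ 2 <= 2 * eps ->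
  spread3 a b c <= 25 * eps -> (a - 1 / 6) ^+ 2 <= 25 * eps.
Proof.
move=> <- H1 H2; have := sqr_ge0 (b - c).
have := sqr_ge0 ((2 * a - b - c) - (a + b + c - 1 / 2)).
have := sqr_ge0 (a + b + c - 1 / 2).
rewrite /spread3 in H2; rewrite !expr2 in H1 H2 *; lra.
Qed.

Lemma K3K3_poly_stable_half a b c d e f eps :
  0 <= a -> 0 <= b -> 0 <= c -> 0 <= d -> 0 <= e -> 0 <= f ->
  a + b + c + (d + e + f) = 1 -> d + e + f <= a + b + c -> eps < 1 / 288 ->
  1 / 108 - 2 / 27 * eps <= K3K3_poly a b c d e f ->
  [/\ (a - 1 / 6) ^+ 2 <= 25 * eps, (b - 1 / 6) ^+ 2 <= 25 * eps
    & (c - 1 / 6) ^+ 2 <= 25 * eps] /\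
  [/\ (d - 1 / 6) ^+ 2 <= 25 * eps, (e - 1 / 6) ^+ 2 <= 25 * eps
    & (f - 1 / 6) ^+ 2 <= 25 * eps].
Proof.
move=> a0 b0 c0 d0 e0 f0 s1 st eps0 H.
have D_le x y z : 0 <= x -> 0 <= y -> 0 <= z -> spread3 x y z <= (x + y + z) ^+ 2.
  move=> x0 y0 z0; rewrite -subr_ge0.
  have -> : (x + y + z) ^+ 2 - spread3 x y z = 3 * (x * y + y * z + z * x) by rewrite /spread3; ring.
  by rewrite mulr_ge0 // !addr_ge0 ?mulr_ge0.
have t0 : 0 <= d + e + f by rewrite !addr_ge0.
have [|h1 h2 h3] := balance_half s1 st t0 (spread3_ge0 a b c) (D_le _ _ _ a0 b0 c0)
  (spread3_ge0 d e f) (D_le _ _ _ d0 e0 f0) eps0 _.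
  by apply: le_trans _ (K3K3_poly_le a0 b0 c0 d0 e0 f0); lra.
have rot x y z : spread3 y z x = spread3 x y z by rewrite /spread3; ring.
have sE (x y z : R) : y + z + x = x + y + z by ring.
have h1' : (d + e + f - 1 / 2) ^+ 2 <= 2 * eps.
  by rewrite (_ : d + e + f - 1 / 2 = - (a + b + c - 1 / 2)) ?sqrrN //; lra.
split; split.
- exact: third_dev erefl h1 h2.
- by apply: (third_dev (sE a b c) h1); rewrite rot.
- apply: (third_dev (b := a) (c := b) _ h1); first by ring.
  by rewrite -rot.
- exact: third_dev erefl h1' h3.
- by apply: (third_dev (sE d e f) h1'); rewrite rot.
- apply: (third_dev (b := d) (c := e) _ h1'); first by ring.
  by rewrite -rot.
Qed.

End Optimum.

Section OptimumK3K3.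
Variable R : realFieldType.
Lemma K3K3_poly_stable (S : 'I_6 -> R) eps : (forall i, 0 <= S i) ->
  \sum_i S i = 1 -> eps < 1 / 288 ->
  1 / 108 - 2 / 27 * eps <= K3K3_poly (S (inord 0)) (S (inord 1)) (S (inord 2))
     (S (inord 3)) (S (inord 4)) (S (inord 5)) ->
  forall i, (S i - 1 / 6) ^+ 2 <= 25 * eps.
Proof.
move=> S0; rewrite sum_inord6 => S1 eps0 H.
suff [[h0 h1 h2] [h3 h4 h5]] :
  [/\ (S (inord 0) - 1 / 6) ^+ 2 <= 25 * eps, (S (inord 1) - 1 / 6) ^+ 2 <= 25 * eps
    & (S (inord 2) - 1 / 6) ^+ 2 <= 25 * eps] /\
  [/\ (S (inord 3) - 1 / 6) ^+ 2 <= 25 * eps, (S (inord 4) - 1 / 6) ^+ 2 <= 25 * eps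
    & (S (inord 5) - 1 / 6) ^+ 2 <= 25 * eps].
  move=> i; rewrite -(inord_val i); case: i => [[|[|[|[|[|[|i]]]]]] i6] /=.
  - exact h0.
  - exact h1.
  - exact h2.
  - exact h3.
  - exact h4.
  - exact h5.
  - by [].
have [h|/ltW h] := leP (S (inord 3) + S (inord 4) + S (inord 5)) (S (inord 0) + S (inord 1) + S (inord 2)).
  by apply: K3K3_poly_stable_half => //; rewrite -S1; ring.
have [||? ?] // := K3K3_poly_stable_half (S0 (inord 3)) (S0 (inord 4)) (S0 (inord 5))
  (S0 (inord 0)) (S0 (inord 1)) (S0 (inord 2)) _ h eps0 _; first by rewrite -S1; ring.
by rewrite [X in _ <= X]addrC.
Qed.

(** A triangle has no induced P3 on distinct vertices, so both ends of the path must fall in one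
    part. *)
Lemma K3K3_pattern_tup5 : all (fun a => all (fun b => all (fun c => all (fun d => all (fun e =>
  P3K2_pattern (fun i j => K3K3_adj (nth 0%N [:: a; b; c; d; e] i) (nth 0%N [:: a; b; c; d; e] j)) ==
  [&& K3K3_adj a b, c == a, K3K3_adj d e & (a < 3)%N != (d < 3)%N])
  (iota 0 6)) (iota 0 6)) (iota 0 6)) (iota 0 6)) (iota 0 6).
Proof. by vm_compute. Qed.

Lemma psum_K3K3 (S : 'I_6 -> R) :
  psum K3K3 S (fun e => (P3K2_pattern e)%:R) =
  K3K3_poly (S (inord 0)) (S (inord 1)) (S (inord 2)) (S (inord 3)) (S (inord 4)) (S (inord 5)).
Proof.
rewrite /psum sum_tup5.
transitivity (\sum_(a : 'I_6) \sum_(b : 'I_6) (K3K3_adj a b)%:R * (S a ^+ 2 * S b) *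
  \sum_(d : 'I_6) \sum_(e : 'I_6) ((K3K3_adj d e) && ((a < 3)%N != (d < 3)%N))%:R * (S d * S e)).
  apply: eq_bigr => a _; apply: eq_bigr => b _; rewrite (bigD1 a) //= [X in _ + X]big1 ?addr0.
    rewrite mulr_sumr; apply: eq_bigr => d _; rewrite mulr_sumr; apply: eq_bigr => e _.
    rewrite prod_tup5 /P3K2_pattern !pat_tup5 //= !adj_K3K3.
    have := K3K3_pattern_tup5.
    have I (x : 'I_6) : (x : nat) \in iota 0 6 by rewrite mem_iota ltn_ord.
    move=> /allP/(_ _ (I a))/allP/(_ _ (I b))/allP/(_ _ (I a))/allP/(_ _ (I d))/allP/(_ _ (I e)).
    rewrite /P3K2_pattern /= eqxx => /eqP ->.
    case: (K3K3_adj a b); case: (K3K3_adj d e); case: (_ != _) => /=; ring.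
  move=> c /negbTE ca; apply: big1 => d _; apply: big1 => e _.
  rewrite prod_tup5 /P3K2_pattern !pat_tup5 //= !adj_K3K3.
  have := K3K3_pattern_tup5.
  have I (x : 'I_6) : (x : nat) \in iota 0 6 by rewrite mem_iota ltn_ord.
  move=> /allP/(_ _ (I a))/allP/(_ _ (I b))/allP/(_ _ (I c))/allP/(_ _ (I d))/allP/(_ _ (I e)).
  rewrite /P3K2_pattern /= (inj_eq val_inj) ca andbF => /eqP ->.
  by rewrite mulr0.
rewrite !sum_inord6. rewrite /K3K3_adj !inordK //=.
rewrite /K3K3_poly /cherry3 /edge3; ring.
Qed.

End OptimumK3K3.

Section Blowup.
Variables (R : realFieldType) (m : nat) (T : finType) (B : graph 'I_m) (c : T -> 'I_m).

Definition part_weight (w : T -> R) (j : 'I_m) : R := \sum_(v | c v == j) w v.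

(** Exact because repetitions are allowed: two vertices of a part are non-adjacent whether or not
    they coincide, so a tuple matters only through its parts. *)
Lemma psum_blowup (w : T -> R) (phi : pattern -> R) :
  (forall e e', eqpat5 e e' -> phi e = phi e') ->
  psum (blowup B c) w phi = psum B (part_weight w) phi.
Proof.
move=> Pext; rewrite /psum.
rewrite (partition_big (fun f : {ffun 'I_5 -> T} => [ffun i => c (f i)]) xpredT) //=.
apply: eq_bigr => g _.
transitivity (\sum_(f : {ffun 'I_5 -> T} | [ffun i => c (f i)] == g)
    (\prod_i w (f i)) * phi (pat B g)).
  apply: eq_bigr => f /eqP fg; congr (_ * _); apply: Pext => i j i5 j5.
  by rewrite /pat adj_pullback -fg !ffunE.
rewrite -mulr_suml; congr (_ * _).
rewrite /part_weight (bigA_distr_big_dep (fun i v => c v == g i)) /=.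
apply: eq_bigl => f; apply/eqP/familyP => [<- i|H].
  by rewrite ffunE unfold_in.
by apply/ffunP => i; rewrite ffunE; apply/eqP; have := H i; rewrite unfold_in.
Qed.

End Blowup.

(** * Induced copies *)

Section Iso.
Variables T U V : finType.
Lemma iso_sym (G : graph T) (H : graph U) : iso G H -> iso H G.
Proof.
case=> f [g fK gK] fP; exists g; first by exists f.
by move=> x y; rewrite -fP !gK.
Qed.

Lemma iso_trans (G : graph T) (H : graph U) (K : graph V) : iso G H -> iso H K -> iso G K.
Proof.
case=> f fB fP [g gB gP]; exists (g \o f); first exact: bij_comp.
by move=> x y; rewrite /= gP fP.
Qed.

End Iso.

Definition P3K2_adj (i j : nat) : bool :=
  match i, j with 0, 1 | 1, 0 | 1, 2 | 2, 1 | 3, 4 | 4, 3 => true | _, _ => false end%N.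

Lemma adj_P3K2 (i j : 'I_5) : adj P3K2 i j = P3K2_adj i j.
Proof.
rewrite /P3K2 adj_graph_of -(inj_eq val_inj) /=.
case: (@splitP 3 2 i) => i' ->; case: (@splitP 3 2 j) => j' ->; rewrite ?adj_graph_of -?(inj_eq val_inj) /=;
  by case: i' => [[|[|[|i']]]] // ?; case: j' => [[|[|[|j']]]].
Qed.

Lemma P3K2_patternP (e : pattern) : (forall i j, e i j = e j i) -> (forall i, e i i = false) ->
  reflect (eqpat5 e P3K2_adj) (P3K2_pattern e).
Proof.
move=> es ei; apply: (iffP idP) => [|H]; last by rewrite /P3K2_pattern !H.
rewrite /P3K2_pattern => /and5P[e01 e12 e34 /negbTE e02 /and5P[/negbTE e03 /negbTE e04
  /negbTE e13 /negbTE e14 /andP[/negbTE e23 /negbTE e24]]] i j i5 j5.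
case: i i5 => [|[|[|[|[|i]]]]] // _; case: j j5 => [|[|[|[|[|j]]]]] // _ /=;
  by rewrite ?ei // es.
Qed.

Section Count.
Variables (T : finType) (G : graph T).

Lemma has_P3K2_iso (f : {ffun 'I_5 -> T}) :
  has_P3K2 (pat G f) <-> iso (pullback G f) P3K2.
Proof.
split.
  case/hasP=> p pp; rewrite -(eqpat5_P3K2 (pat_fcomp G f p)).
  move=> /(P3K2_patternP (pat_sym G _) (pat_irr G _)) H.
  have [s' sK s'K] : bijective (fun i : 'I_5 => inord (nth 0%N p i) : 'I_5).
    exact/injF_bij/inord_perms5_inj.
  exists s'; first by exists (fun i : 'I_5 => inord (nth 0%N p i) : 'I_5).
  move=> x y; rewrite adj_P3K2 -H // /pat !ffunE !inordK // adj_pullback.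
  by move: (s'K x) (s'K y) => /= -> ->.
case=> g [h gK hK] gP.
have pp : [seq val (h i) | i <- enum 'I_5] \in perms5.
  rewrite mem_permutations -val_enum_ord (map_comp val h) perm_map //.
  apply: uniq_perm; rewrite ?enum_uniq ?(map_inj_uniq (can_inj hK)) ?enum_uniq // => i.
  by rewrite mem_enum; apply/mapP; exists (g i); rewrite ?mem_enum ?gK.
apply/hasP; exists [seq val (h i) | i <- enum 'I_5] => //.
rewrite -(eqpat5_P3K2 (pat_fcomp G f _)).
apply/P3K2_patternP; [exact: pat_sym | exact: pat_irr | move=> i j i5 j5].
have nE k (k5 : (k < 5)%N) : fcomp f [seq val (h i) | i <- enum 'I_5] (inord k) = f (h (inord k)).
  rewrite ffunE inordK // (nth_map ord0) ?size_enum_ord // inord_val; congr (f (h _)).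
  by apply: val_inj; rewrite /= nth_enum_ord // inordK.
rewrite /pat !nE // -adj_pullback -gP !hK adj_P3K2 !inordK //.
Qed.

Lemma iso_pullback_induced (f : {ffun 'I_5 -> T}) (X : {set T}) :
  injective f -> f @: [set: 'I_5]%SET = X -> iso (pullback G f) (Defs.induced G X).
Proof.
move=> fI fX.
have fP i : f i \in X by rewrite -fX; apply: imset_f.
exists (fun i => Sub (f i) (fP i) : {x | x \in X}).
  apply: inj_card_bij => [i j /(congr1 val) /fI //|].
  rewrite (_ : #|_| = #|X|); last by rewrite card_sig; apply: eq_card => x; rewrite !inE.
  by rewrite -fX card_imset // cardsT.
by move=> i j; rewrite !adj_pullback.
Qed.

Lemma count_injective_has :
  #|[set f : {ffun 'I_5 -> T} | injectiveb f && has_P3K2 (pat G f)]%SET| =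
  (120 * induced_count P3K2 G)%N.
Proof.
rewrite -sum1_card (partition_big (fun f : {ffun 'I_5 -> T} => f @: [set: 'I_5]%SET)
  (fun X : {set T} => (#|X| == 5) && `[< iso (Defs.induced G X) P3K2 >])) /=; last first.
  move=> f; rewrite inE => /andP[/injectiveP fI /has_P3K2_iso fP].
  rewrite card_imset // cardsT card_ord eqxx; apply/asboolP.
  exact: iso_trans (iso_sym (iso_pullback_induced fI erefl)) fP.
rewrite /induced_count -sum1_card big_distrr /= [RHS](eq_bigl (fun X : {set T} => (#|X| == 5) && `[< iso (Defs.induced G X) P3K2 >])); last first.
  by move=> X; rewrite inE card_ord.
apply: eq_bigr => X /andP[/eqP X5 /asboolP XP].
rewrite muln1 sum1_card.
have := @card_inj_ffuns_on 'I_5 T (mem X).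
rewrite card_ord (_ : #|mem X| = 5%N) // => E.
rewrite -[RHS]/(5 ^_ 5)%N -E {E}.
apply: eq_card => f; rewrite unfold_in !inE.
apply/idP/idP.
  case/andP=> /andP[fI _] /eqP fX; rewrite fI andbT.
  by apply/ffun_onP => i; rewrite -fX; apply: imset_f.
case/andP=> /ffun_onP fX fI; rewrite fI /=.
have fXE : f @: [set: 'I_5]%SET = X.
  apply/eqP; rewrite eqEcard card_imset ?cardsT ?card_ord ?X5 //; last exact/injectiveP.
  by rewrite leqnn andbT; apply/fintype.subsetP => _ /imsetP[i _ ->].
rewrite fXE eqxx andbT; apply/has_P3K2_iso.
exact: iso_trans (iso_pullback_induced (elimT (injectiveP _) fI) fXE) XP.
Qed.

(** Double counting over relabellings: each copy has 120 injective labellings, and each of these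
    matches the pattern after exactly four of the 120 relabellings. *)
Lemma count_injective_P3K2 :
  #|[set f : {ffun 'I_5 -> T} | injectiveb f && P3K2_pattern (pat G f)]%SET| =
  (4 * induced_count P3K2 G)%N.
Proof.
have E (P : {ffun 'I_5 -> T} -> bool) :
    #|[set f : {ffun 'I_5 -> T} | injectiveb f && P f]%SET| =
    (\sum_(f : {ffun 'I_5 -> T} | injectiveb f) P f)%N.
  rewrite -sum1_card (eq_bigl (fun f : {ffun 'I_5 -> T} => injectiveb f && P f)).
    by rewrite big_mkcondr; apply: eq_bigr => f _; case: (P f).
  by move=> f; rewrite inE.
apply/eqP; rewrite -(eqn_pmul2l (isT : 0 < 120)%N) mulnCA -count_injective_has !E; apply/eqP.
have size120 : size perms5 = 120%N by vm_compute.
transitivity (\sum_(p <- perms5) \sum_(f : {ffun 'I_5 -> T} | injectiveb f)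
   P3K2_pattern (relabel p (pat G f)))%N.
  rewrite (eq_big_seq (fun=> \sum_(f : {ffun 'I_5 -> T} | injectiveb f)
     P3K2_pattern (pat G f))%N).
    by rewrite big_const_seq iter_addn_0 count_predT size120 mulnC.
  move=> p pp; rewrite [RHS](reindex (fun f : {ffun 'I_5 -> T} => fcomp f p)) /=; last first.
    by case: (fcomp_bij T pp) => g gK fK; exists g => x _; [apply: gK | apply: fK].
  apply: eq_big => [f|f _]; last by rewrite (eqpat5_P3K2 (pat_fcomp G f p)).
  have [s' sK s'K] : bijective (fun i : 'I_5 => inord (nth 0%N p i) : 'I_5).
    exact/injF_bij/inord_perms5_inj.
  apply/injectiveP/injectiveP => fI i j.
    by rewrite !ffunE => /fI; apply: can_inj sK _ _.
  move=> E'; have := fI (s' i) (s' j); rewrite !ffunE.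
  by move: (s'K i) (s'K j) => /= -> -> /(_ E') /(can_inj s'K).
rewrite exchange_big big_distrr /=; apply: eq_bigr => f _.
have Pext e e' : eqpat5 e e' ->
    (count (fun p => P3K2_pattern (relabel p e)) perms5 == 4 * has_P3K2 e)%N =
    (count (fun p => P3K2_pattern (relabel p e')) perms5 == 4 * has_P3K2 e')%N.
  move=> ee'; congr (_ == 4 * nat_of_bool _)%N.
    by apply: eq_in_count => p pp; apply: eqpat5_P3K2; apply: eqpat5_relabel.
  by apply: eq_in_has => p pp; apply: eqpat5_P3K2; apply: eqpat5_relabel.
have /eqP <- := all_graph5_pat G f Pext count_P3K2.
by rewrite -sum1_count [RHS]big_mkcond; apply: eq_bigr => p _; case: P3K2_pattern.
Qed.

End Count.

(** * Comparing two graphs on the same vertex set *)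

Lemma sum_two_coords (R : realFieldType) (T : finType) (i j : 'I_5) (F : T -> T -> R) : i != j ->
  \sum_(f : {ffun 'I_5 -> T}) F (f i) (f j) = #|T|%:R ^+ 3 * \sum_u \sum_v F u v.
Proof.
move=> ij; have ji : j != i by rewrite eq_sym.
pose h (u v : T) (k : 'I_5) (x : T) : R := (if k == i then (x == u)%:R else if k == j then (x == v)%:R else 1).
have H u v : \sum_(f : {ffun 'I_5 -> T}) ((f i == u) && (f j == v))%:R = #|T|%:R ^+ 3 :> R.
  have delta (y : T) : \sum_x (x == y)%:R = 1 :> R.
    by rewrite (bigD1 y) //= eqxx big1 ?addr0 // => x /negbTE ->.
  transitivity (\prod_k \sum_x h u v k x).
    rewrite bigA_distr_bigA; apply: eq_bigr => f _.
    rewrite (bigD1 i) //= (bigD1 j) //= big1 ?mulr1.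
      by rewrite /h eqxx (negbTE ji) eqxx -natrM mulnb.
    by move=> k /andP[/negbTE ki /negbTE kj]; rewrite /h ki kj.
  rewrite (bigD1 i) //= (bigD1 j) //= {1 2}/h eqxx (negbTE ji) eqxx !delta !mul1r.
  rewrite (eq_bigr (fun=> #|T|%:R)).
    rewrite prodr_const; congr (_ ^+ _).
    rewrite (eq_card (B := ~: [set i; j]%SET)); last by move=> k; rewrite !inE negb_or.
    by rewrite cardsCs finset.setCK cards2 ij card_ord.
  by move=> k /andP[/negbTE ki /negbTE kj]; rewrite /h ki kj sumr_const.
rewrite mulr_sumr.
under [RHS]eq_bigr => u _ do rewrite mulr_sumr.
under [RHS]eq_bigr => u _ do under eq_bigr => v _ do rewrite -(H u v) mulr_suml.
rewrite (eq_bigr (fun u => \sum_(f : {ffun 'I_5 -> T}) \sum_v ((f i == u) && (f j == v))%:R * F u v)); last first.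
  by move=> u _; rewrite exchange_big.
rewrite exchange_big; apply: eq_bigr => f _.
rewrite (bigD1 (f i)) //= (bigD1 (f j)) //= !eqxx mul1r !big1 ?addr0 //.
  by move=> u /negbTE uf; apply: big1 => v _; rewrite eq_sym uf mul0r.
by move=> v /negbTE vf; rewrite [f j == v]eq_sym vf mul0r.
Qed.

Section Compare.
Variables (R : realFieldType) (T : finType).
Implicit Types G H : graph T.

Definition discrepancy G H : R := \sum_u \sum_v (adj G u v != adj H u v)%:R.

Lemma misplaced_discrepancy G (c : T -> 'I_6) :
  misplaced R G c = discrepancy G (blowup K3K3 c).
Proof. by apply: eq_bigr => u _; apply: eq_bigr => v _; rewrite adj_pullback. Qed.

Lemma pattern_diff (P : pattern -> bool) G H (f : {ffun 'I_5 -> T}) :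
  (forall e e', eqpat5 e e' -> P e = P e') ->
  `|(P (pat G f))%:R - (P (pat H f))%:R| <=
  \sum_(i : 'I_5) \sum_(j : 'I_5 | i != j) (adj G (f i) (f j) != adj H (f i) (f j))%:R :> R.
Proof.
move=> Pext.
have [/existsP[i /existsP[j ij]]|/existsPn N] :=
  boolP [exists i : 'I_5, exists j : 'I_5, adj G (f i) (f j) != adj H (f i) (f j)].
  have inej : i != j by apply: contraNneq ij => ->; rewrite !adj_irrefl.
  rewrite (bigD1 i) //= (bigD1 j) //= ij -addrA.
  apply: (@le_trans _ _ 1); first by case: (P _); case: (P _); rewrite ?subrr ?subr0 ?sub0r ?normrN ?normr0 ?normr1.
  by rewrite lerDl addr_ge0 //; repeat (apply: sumr_ge0 => ? _).
have -> : P (pat G f) = P (pat H f).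
  apply: Pext => i j i5 j5; rewrite /pat.
  by have /existsPn/(_ (inord j))/negPn/eqP := N (inord i).
by rewrite subrr normr0; repeat (apply: sumr_ge0 => ? _).
Qed.

(** A tuple changes status only if one of its 20 ordered index pairs hits a pair where [G] and [H]
    differ; the other three coordinates are free. *)
Lemma weighted_diff (P : pattern -> bool) G H (k : {ffun 'I_5 -> T} -> R) K :
  (forall e e', eqpat5 e e' -> P e = P e') -> (forall f, `|k f| <= K) ->
  `|\sum_f k f * ((P (pat G f))%:R - (P (pat H f))%:R)| <=
  K * (20 * #|T|%:R ^+ 3 * discrepancy G H).
Proof.
move=> Pext kK; apply: le_trans (ler_norm_sum _ _ _) _.
apply: (@le_trans _ _ (\sum_(f : {ffun 'I_5 -> T}) K *
  \sum_(i : 'I_5) \sum_(j : 'I_5 | i != j) (adj G (f i) (f j) != adj H (f i) (f j))%:R)).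
  apply: ler_sum => f _; rewrite normrM; apply: ler_pM => //; exact: pattern_diff.
rewrite -mulr_sumr exchange_big /=.
rewrite (eq_bigr (fun i : 'I_5 => \sum_(j : 'I_5 | i != j) #|T|%:R ^+ 3 * discrepancy G H)); last first.
  move=> i _; rewrite exchange_big /=; apply: eq_bigr => j ij.
  exact: (sum_two_coords (fun u v => (adj G u v != adj H u v)%:R)).
rewrite (eq_bigr (fun i : 'I_5 => (#|T|%:R ^+ 3 * discrepancy G H) *+ 4)); last first.
  move=> i _; rewrite sumr_const; congr (_ *+ _).
  rewrite (eq_card (B := [set~ i]%SET)); last by move=> j; rewrite !inE eq_sym.
  by rewrite cardsC1 card_ord.
rewrite sumr_const card_ord -mulrnA -[_ *+ (4 * 5)]mulr_natl !mulrA; exact: lexx.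
Qed.

Definition frames G : R := \sum_x \sum_y \sum_z \sum_t (two_edges G x y z t)%:R.

Lemma frames_le G : frames G <= #|T|%:R ^+ 4.
Proof.
apply: (@le_trans _ _ (\sum_(x : T) \sum_(y : T) \sum_(z : T) \sum_(t : T) 1)).
  by do 4 (apply: ler_sum => ? _); case: two_edges.
by rewrite !sumr_const -!mulrnA -natrX !expnS expn0 muln1 !mulnA.
Qed.

Lemma frames_diff G H : frames G - frames H <= 6 * #|T|%:R ^+ 2 * discrepancy G H.
Proof.
pose d u v : R := (adj G u v != adj H u v)%:R; pose n : R := #|T|%:R.
pose s4 (F : T -> T -> T -> T -> R) := \sum_x \sum_y \sum_z \sum_t F x y z t.
have s4D F F' : s4 (fun x y z t => F x y z t + F' x y z t) = s4 F + s4 F'.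
  rewrite /s4 -big_split; apply: eq_bigr => x _; rewrite -big_split; apply: eq_bigr => y _.
  by rewrite -big_split; apply: eq_bigr => z _; rewrite -big_split.
have c1 (a : R) : \sum_(x : T) a = n * a by rewrite sumr_const mulr_natl.
have W : discrepancy G H = \sum_u \sum_v d u v by [].
have E1 : s4 (fun x y _ _ => d x y) = n ^+ 2 * discrepancy G H.
  rewrite /s4 W mulr_sumr; apply: eq_bigr => x _; rewrite mulr_sumr; apply: eq_bigr => y _.
  by rewrite !c1 mulrA.
have E2 : s4 (fun _ _ z t => d z t) = n ^+ 2 * discrepancy G H.
  by rewrite /s4 !c1 mulrA.
have E3 : s4 (fun x _ z _ => d x z) = n ^+ 2 * discrepancy G H.
  rewrite /s4 W mulr_sumr; apply: eq_bigr => x _; rewrite c1 -mulrA; congr (_ * _).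
  by rewrite mulr_sumr; apply: eq_bigr => z _; rewrite c1.
have E4 : s4 (fun x _ _ t => d x t) = n ^+ 2 * discrepancy G H.
  by rewrite /s4 W mulr_sumr; apply: eq_bigr => x _; rewrite !c1 mulrA.
have E5 : s4 (fun _ y z _ => d y z) = n ^+ 2 * discrepancy G H.
  rewrite /s4 W c1 -mulrA; congr (_ * _); rewrite mulr_sumr; apply: eq_bigr => y _.
  by rewrite mulr_sumr; apply: eq_bigr => z _; rewrite c1.
have E6 : s4 (fun _ y _ t => d y t) = n ^+ 2 * discrepancy G H.
  rewrite /s4 W c1 -mulrA; congr (_ * _); rewrite mulr_sumr; apply: eq_bigr => y _.
  by rewrite c1.
rewrite -/n (_ : 6 * _ * _ = s4 (fun x y z t => d x y + d z t + d x z + d x t + d y z + d y t)); last first.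
  by rewrite !s4D E1 E2 E3 E4 E5 E6; ring.
rewrite /frames -sumrB; apply: ler_sum => x _; rewrite -sumrB; apply: ler_sum => y _.
rewrite -sumrB; apply: ler_sum => z _; rewrite -sumrB; apply: ler_sum => t _.
have d0 u v : 0 <= d u v by [].
have dB u v : adj G u v = adj H u v \/ d u v = 1.
  by rewrite /d; case: eqVneq; [left | right].
have s0 : 0 <= d x y + d z t + d x z + d x t + d y z + d y t by rewrite !addr_ge0.
have [E|N] := boolP (two_edges G x y z t == two_edges H x y z t).
  by rewrite (eqP E) subrr.
apply: (@le_trans _ _ 1); first by case: two_edges; case: two_edges; rewrite ?subr0 ?subrr ?sub0r //; lra.
have := d0 x y; have := d0 z t; have := d0 x z; have := d0 x t; have := d0 y z; have := d0 y t.
move: N; rewrite /two_edges.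
case: (dB x y) => [->|->]; last lra. case: (dB z t) => [->|->]; last lra.
case: (dB x z) => [->|->]; last lra. case: (dB x t) => [->|->]; last lra.
case: (dB y z) => [->|->]; last lra. case: (dB y t) => [->|->]; last lra.
by rewrite eqxx.
Qed.

(** The ends of the path are the only twins of P3 + K2, so a matching tuple can repeat a vertex only
    by identifying them; what remains is an ordered induced 2K2. Injective matching tuples come four
    to a copy. *)
Lemma count_P3K2_frames G :
  count_pattern R G P3K2_pattern = 4 * (induced_count P3K2 G)%:R + frames G.
Proof.
rewrite count_patternE (bigID (fun f : {ffun 'I_5 -> T} => injectiveb f)) /=; congr (_ + _).
  rewrite -natrM -count_injective_P3K2 -sum1_card natr_sum big_mkcond [RHS]big_mkcond.
  by apply: eq_bigr => f _; rewrite inE; case: (injectiveb f); case: P3K2_pattern.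
transitivity (\sum_(f : {ffun 'I_5 -> T}) ((f (inord 0) == f (inord 2)) && P3K2_pattern (pat G f))%:R : R).
  rewrite big_mkcond; apply: eq_bigr => f _.
  case: (boolP (P3K2_pattern (pat G f))) => [Pf|_]; last by rewrite andbF; case: ifP.
  rewrite andbT; move: Pf => /(P3K2_patternP (pat_sym G _) (pat_irr G _)) Pf.
  have A (i j : 'I_5) : adj G (f i) (f j) = P3K2_adj i j by rewrite -Pf // /pat !inord_val.
  case: eqVneq => f02 /=.
    suff -> : injectiveb f = false by [].
    by apply/negP => /injectiveP/(_ _ _ f02)/(congr1 val); rewrite /= !inordK.
  suff -> : injectiveb f by [].
  apply/injectiveP => i j fij; apply: val_inj => /=.
  have AA k : (k < 5)%N -> P3K2_adj i k = P3K2_adj j k.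
    by move=> k5; rewrite -[k]/(val (Ordinal k5)) -!A fij.
  have B0 : (i = 0 :> nat -> j = 2 :> nat -> False)%N.
    move=> i0 j2; move/eqP: f02; apply; rewrite -(inord_val i) -(inord_val j) i0 j2 in fij; exact: fij.
  have B2 : (i = 2 :> nat -> j = 0 :> nat -> False)%N.
    move=> i0 j2; move/eqP: f02; apply; rewrite -(inord_val i) -(inord_val j) i0 j2 in fij; exact/esym/fij.
  move: AA B0 B2; case: i {fij} => i i5; case: j => j j5 /= AA B0 B2.
  move: (AA 0%N isT) (AA 1%N isT) (AA 3%N isT) (AA 4%N isT).
  case: i i5 {AA} B0 B2 => [|[|[|[|[|i]]]]] // _; case: j j5 => [|[|[|[|[|j]]]]] // _ B0 B2 /= e0 e1 e3 e4;
    first [reflexivity | discriminate e0 | discriminate e1 | discriminate e3 | discriminate e4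
          | by case: B0 | by case: B2].
rewrite sum_tup5 /frames; apply: eq_bigr => x _; apply: eq_bigr => y _.
rewrite (bigD1 x) //= [X in _ + X]big1 ?addr0; last first.
  move=> z /negbTE zx; do 2 (apply: big1 => ? _).
  by rewrite !ffunE !inordK //= eq_sym zx.
apply: eq_bigr => z _; apply: eq_bigr => t _.
rewrite /P3K2_pattern !pat_tup5 //= !ffunE !inordK //= eqxx adj_irrefl /two_edges (adj_sym G y x).
by case: (adj G x y); case: (adj G z t); case: (adj G x z); case: (adj G x t); case: (adj G y z); case: (adj G y t).
Qed.

Lemma count_pattern_le_psum (w : T -> R) (b : R) G P : 0 <= b -> (forall x, b <= w x) ->
  b ^+ 5 * count_pattern R G P <= psum G w (fun e => (P e)%:R).
Proof.
move=> b0 bw; rewrite count_patternE mulr_sumr; apply: ler_sum => f _.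
apply: ler_wpM2r => //.
have -> : b ^+ 5 = \prod_(i < 5) b by rewrite prodr_const card_ord.
apply: ler_prod => i _.
by rewrite b0 bw.
Qed.

End Compare.

(** * The objective function and the growth of its normalisation *)

Section Lambda.
Variables (R : realType).

Lemma induced_count_iso (U U' T : finType) (F : graph U) (F' : graph U') (G : graph T) :
  iso F F' -> induced_count F G = induced_count F' G.
Proof.
move=> FF'; have card_eq : #|U| = #|U'|.
  by case: FF' => f fB _; apply: bij_eq_card fB.
rewrite /induced_count; apply: eq_card => X; rewrite !inE card_eq; congr (_ && _).
apply/asboolP/asboolP => H; first exact: iso_trans H FF'.
exact: iso_trans H (iso_sym FF').
Qed.

Lemma iso_refl (T : finType) (G : graph T) : iso G G.
Proof. by exists id => //; exists id. Qed.

(** [gamma_P3K2] is supported on one isomorphism class, which the transversal meets exactly once. *)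
Lemma Lambda_P3K2 (T : finType) (G : graph T) :
  Lambda (@gamma_P3K2 R) G = (induced_count P3K2 G)%:R.
Proof.
pose r := fun F F' : graph 'I_5 => `[< iso F F' >].
have rE : {in [set: graph 'I_5]%SET & &, equivalence_rel r}.
  move=> F F' F'' _ _ _; split; first by apply/asboolP; exact: iso_refl.
  move=> /asboolP FF'; apply/asboolP/asboolP => H; last exact: iso_trans FF' H.
  exact: iso_trans (iso_sym FF') H.
have pP := equivalence_partitionP rE.
have /and3P[_ _ /forall_inP tP] := transversalP pP.
have pb : finset.pblock (equivalence_partition r [set: graph 'I_5]%SET) P3K2 \in
    equivalence_partition r [set: graph 'I_5]%SET.
  by apply: pblock_mem; rewrite (cover_partition pP) inE.
have /cards1P[F0 F0E] := tP _ pb.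
have blockE F : (F \in finset.pblock (equivalence_partition r [set: graph 'I_5]%SET) P3K2) = r P3K2 F.
  by rewrite (pblock_equivalence_partition rE) ?inE.
rewrite /Lambda (bigID (fun F => r P3K2 F)) /= [X in _ + X]big1 ?addr0; last first.
  move=> F /andP[_ N]; rewrite /gamma_P3K2; case: asboolP => [FP|_]; last by rewrite mul0r.
  by case/negP: N; apply/asboolP/iso_sym.
rewrite (eq_bigl (pred1 F0)) => [|F]; last first.
  by rewrite -blockE -finset.in_setI /iso_representatives F0E inE.
rewrite big_pred1_eq.
have : F0 \in [set F0]%SET by rewrite inE.
rewrite -F0E finset.in_setI => /andP[_]; rewrite blockE => /asboolP FP.
rewrite /gamma_P3K2; case: asboolP => [_|[]]; last exact: iso_sym.
by rewrite mul1r (induced_count_iso G (iso_sym FP)).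
Qed.

End Lambda.

Section Ratios.
Variable R : realType.

Lemma invn_cvg0 : (n%:R : R)^-1 @[n --> \oo] --> (0 : R).
Proof.
apply/(gtr0_cvgV0 (f := fun n => n%:R : R)); last exact: cvgr_idn.
by near do rewrite ltr0n; exact: nbhs_infty_gt.
Unshelve. all: by end_near. Qed.

Lemma ratio_cvg (u : nat -> R) (a K : R) :
  (forall n, `|u n - a * n%:R| <= K) -> u n / n%:R @[n --> \oo] --> a.
Proof.
move=> H.
have -> : a = a + 0 by rewrite addr0.
have C (k : R) : k * (n%:R)^-1 @[n --> \oo] --> (0 : R).
  by rewrite -[X in _ --> X](mulr0 k); apply: cvgM; [exact: cvg_cst | exact: invn_cvg0].
apply: (@cvg_trans _ (a + (u n - a * n%:R) / n%:R @[n --> \oo])).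
  apply: near_eq_cvg; near=> n.
  have n0 : n%:R != 0 :> R by rewrite pnatr_eq0 -lt0n; near: n; exact: nbhs_infty_gt.
  by rewrite mulrBl mulfK // addrC subrK.
apply: cvgD; first exact: cvg_cst.
apply: (squeeze_cvgr (f := fun n => - K * (n%:R)^-1) (h := fun n => K * (n%:R)^-1)); [|exact: C|exact: C].
near=> n; have := H n; rewrite ler_norml => /andP[h1 h2].
by rewrite !ler_wpM2r // invr_ge0.
Unshelve. all: by end_near. Qed.

(** The order [k n] is only close to [n], because the class sizes [a_i n + O(1)] of a blow-up add up
    to [n + O(1)]. *)
Lemma bin5_ratio_cvg (k : nat -> nat) (K : R) : (forall n, `|(k n)%:R - n%:R| <= K) ->
  'C(k n, 5)%:R / n%:R ^+ 5 @[n --> \oo] --> (1 / 120 : R).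
Proof.
move=> H.
have Hj j : (iter j predn (k n))%:R / n%:R @[n --> \oo] --> (1 : R).
  apply: (@ratio_cvg _ _ (K + j%:R)) => n; rewrite mul1r.
  have : `|(iter j predn (k n))%:R - (k n)%:R| <= j%:R :> R.
    elim: j => [|j IH] /=; first by rewrite subrr normr0.
    case: (iter j predn (k n)) IH => [|m] /= IH.
      by apply: le_trans IH _; rewrite ler_nat.
    rewrite -natr1; apply: le_trans (ler_distD m.+1%:R _ _) _.
    by rewrite addrC lerD // -natr1 opprD addrA subrr sub0r normrN normr1.
  by move=> h; rewrite [K + _]addrC; apply: le_trans (ler_distD (k n)%:R _ _) _; rewrite lerD.
have -> : (fun n => 'C(k n, 5)%:R / n%:R ^+ 5) = (fun n =>
  ((iter 0 predn (k n))%:R / n%:R) * (((iter 1 predn (k n))%:R / n%:R) *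
  (((iter 2 predn (k n))%:R / n%:R) * (((iter 3 predn (k n))%:R / n%:R) *
  (((iter 4 predn (k n))%:R / n%:R) * (1 / 120)))))) :> (nat -> R).
  apply/funext => n.
  have := bin_ffact (k n) 5; rewrite !ffactnS ffactn0 muln1 => /(congr1 (fun m => m%:R : R)).
  rewrite natrM (_ : (5`!)%:R = 120) // => E.
  have {E}-> : 'C(k n, 5)%:R = (k n * ((k n).-1 * ((k n).-1.-1 * ((k n).-1.-1.-1 *
      (k n).-1.-1.-1.-1))))%:R / 120 :> R by rewrite -E mulfK.
  rewrite !natrM /= -exprVn; ring.
rewrite -[X in _ --> X]mul1r; apply: cvgM; first exact: Hj.
rewrite -[X in _ --> X]mul1r; apply: cvgM; first exact: Hj.
rewrite -[X in _ --> X]mul1r; apply: cvgM; first exact: Hj.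
rewrite -[X in _ --> X]mul1r; apply: cvgM; first exact: Hj.
rewrite -[X in _ --> X]mul1r; apply: cvgM; first exact: Hj.
exact: cvg_cst.
Qed.

End Ratios.

(** * Limits of densities *)

Section Limits.
Variable R : realType.

Definition K3K3_fun (S : 'I_6 -> R) : R := K3K3_poly (S (inord 0)) (S (inord 1))
  (S (inord 2)) (S (inord 3)) (S (inord 4)) (S (inord 5)).

Lemma K3K3_funZ (S : 'I_6 -> R) r : K3K3_fun (fun i => r * S i) = r ^+ 5 * K3K3_fun S.
Proof. by rewrite /K3K3_fun /K3K3_poly /cherry3 /edge3; ring. Qed.

Lemma K3K3_fun_const r : K3K3_fun (fun=> r / 6) = r ^+ 5 / 108.
Proof. by rewrite /K3K3_fun /K3K3_poly /cherry3 /edge3; field. Qed.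

Lemma edge3_cvg (u v w : nat -> R) a b c :
  u n @[n --> \oo] --> a -> v n @[n --> \oo] --> b -> w n @[n --> \oo] --> c ->
  edge3 (u n) (v n) (w n) @[n --> \oo] --> edge3 a b c.
Proof.
move=> hu hv hw.
exact: (cvgM (cvg_cst _) (cvgD (cvgD (cvgM hu hv) (cvgM hv hw)) (cvgM hw hu))).
Qed.

Lemma cherry3_cvg (u v w : nat -> R) a b c :
  u n @[n --> \oo] --> a -> v n @[n --> \oo] --> b -> w n @[n --> \oo] --> c ->
  cherry3 (u n) (v n) (w n) @[n --> \oo] --> cherry3 a b c.
Proof.
move=> hu hv hw; rewrite /cherry3 !expr2; under eq_fun do rewrite !expr2.
exact: (cvgD (cvgD (cvgM (cvgM hu hu) (cvgD hv hw)) (cvgM (cvgM hv hv) (cvgD hu hw)))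
  (cvgM (cvgM hw hw) (cvgD hu hv))).
Qed.

Lemma K3K3_fun_cvg (S : nat -> 'I_6 -> R) (a : 'I_6 -> R) :
  (forall i, S n i @[n --> \oo] --> a i) -> K3K3_fun (S n) @[n --> \oo] --> K3K3_fun a.
Proof.
move=> H.
have c1 := cherry3_cvg (H (inord 0)) (H (inord 1)) (H (inord 2)).
have c2 := cherry3_cvg (H (inord 3)) (H (inord 4)) (H (inord 5)).
have e1 := edge3_cvg (H (inord 0)) (H (inord 1)) (H (inord 2)).
have e2 := edge3_cvg (H (inord 3)) (H (inord 4)) (H (inord 5)).
exact: (cvgD (cvgM c1 e2) (cvgM c2 e1)).
Qed.

Lemma count_P3K2_le (T : finType) (G : graph T) :
  count_pattern R G P3K2_pattern <= #|T|%:R ^+ 5 / 108.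
Proof.
have := @flag_inequality R T G (fun=> 1) (fun=> ler01).
rewrite sumr_const => H; apply: le_trans H _.
rewrite gerBl; apply: divr_ge0; last exact: ler0n.
by apply: sumr_ge0 => f _; rewrite big1 // mul1r.
Qed.

Lemma copies_le (T : finType) (G : graph T) :
  (induced_count P3K2 G)%:R <= #|T|%:R ^+ 5 / 432 :> R.
Proof.
have := count_P3K2_le G; rewrite count_P3K2_frames.
have : 0 <= frames R G by do 4 (apply: sumr_ge0 => ? _).
lra.
Qed.

Lemma lambdaE (T : finType) (G : graph T) :
  lambda (@gamma_P3K2 R) G = (induced_count P3K2 G)%:R / 'C(#|T|, 5)%:R.
Proof. by rewrite /lambda Lambda_P3K2. Qed.

Definition part_size (T : finType) (c : T -> 'I_6) (i : 'I_6) : nat := #|[pred v | c v == i]|.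

Lemma part_weight1 (T : finType) (c : T -> 'I_6) i :
  part_weight c (fun=> 1 : R) i = (part_size c i)%:R.
Proof. by rewrite /part_weight sumr_const. Qed.

Lemma sum_part_size (T : finType) (c : T -> 'I_6) : (\sum_i part_size c i)%N = #|T|.
Proof.
rewrite -sum1_card (partition_big c xpredT) //=; apply: eq_bigr => i _.
by rewrite sum1_card; apply: eq_card => v; rewrite !inE.
Qed.

Lemma P3K2_ext e e' : eqpat5 e e' -> (P3K2_pattern e)%:R = (P3K2_pattern e')%:R :> R.
Proof. by move/eqpat5_P3K2->. Qed.

Lemma psum_blowup_K3K3 (T : finType) (c : T -> 'I_6) (w : T -> R) :
  psum (blowup K3K3 c) w (fun e => (P3K2_pattern e)%:R) = K3K3_fun (part_weight c w).
Proof. by rewrite psum_blowup ?psum_K3K3 //; exact: P3K2_ext. Qed.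

Lemma count_blowup (T : finType) (c : T -> 'I_6) :
  count_pattern R (blowup K3K3 c) P3K2_pattern = K3K3_fun (fun i => (part_size c i)%:R).
Proof.
rewrite /count_pattern psum_blowup_K3K3; congr K3K3_fun; apply/funext => i; exact: part_weight1.
Qed.

(** The factor 30 is 5! divided by the four tuples per copy; the tuples with a repeated vertex are
    only [O(n^4)] and vanish in the limit. *)
Lemma lambda_blowup_cvg (T : nat -> finType) (c : forall n, T n -> 'I_6) (a : 'I_6 -> R) (K : R) :
  \sum_i a i = 1 -> (forall n i, `|(part_size (c n) i)%:R - a i * n%:R| <= K) ->
  lambda (@gamma_P3K2 R) (blowup K3K3 (c n)) @[n --> \oo] --> 30 * K3K3_fun a.
Proof.
move=> a1 H; pose k n := #|T n|.
have kH n : `|(k n)%:R - n%:R| <= K *+ 6.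
  have nE : n%:R = \sum_i a i * n%:R by rewrite -mulr_suml a1 mul1r.
  rewrite /k -(sum_part_size (c n)) natr_sum [in X in X <= _]nE -sumrB.
  apply: le_trans (ler_norm_sum _ _ _) _.
  have -> : K *+ 6 = \sum_(i < 6) K by rewrite sumr_const card_ord.
  apply: ler_sum => i _; exact: H.
have S_cvg i : (part_size (c n) i)%:R / n%:R @[n --> \oo] --> a i.
  by apply: (@ratio_cvg _ _ _ K) => n; exact: H.
have k_cvg : (k n)%:R / n%:R @[n --> \oo] --> (1 : R).
  by apply: (@ratio_cvg _ _ _ (K *+ 6)) => n; rewrite mul1r.
have M_cvg := K3K3_fun_cvg S_cvg.
pose M n := K3K3_fun (fun i => (part_size (c n) i)%:R / n%:R).
pose D n := (frames R (blowup K3K3 (c n))) / n%:R ^+ 5.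
have D_cvg : D n @[n --> \oo] --> (0 : R).
  have U : ((k n)%:R / n%:R) * (((k n)%:R / n%:R) * (((k n)%:R / n%:R) * (((k n)%:R / n%:R) * (n%:R)^-1)))
      @[n --> \oo] --> (0 : R).
    rewrite -[X in _ --> X](mulr0 1); apply: cvgM => //.
    rewrite -[X in _ --> X](mulr0 1); apply: cvgM => //.
    rewrite -[X in _ --> X](mulr0 1); apply: cvgM => //.
    rewrite -[X in _ --> X](mulr0 1); apply: cvgM => //; exact: invn_cvg0.
  apply: (squeeze_cvgr _ (cvg_cst (0 : R)) U); near=> n.
  apply/andP; split.
    apply: divr_ge0; last by rewrite exprn_ge0.
    by do 4 (apply: sumr_ge0 => ? _).
  apply: le_trans (ler_wpM2r _ (frames_le R _)) _; first by rewrite invr_ge0 exprn_ge0.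
  by rewrite -exprVn /k le_eqVlt; apply/orP; left; apply/eqP; ring.
have C_cvg := bin5_ratio_cvg kH.
have -> : 30 * K3K3_fun a = ((K3K3_fun a - 0) * 4^-1) * (1 / 120)^-1 by rewrite subr0; field.
have Ccvg' : ('C(k n, 5)%:R / n%:R ^+ 5)^-1 @[n --> \oo] --> ((1 / 120)^-1 : R).
  by apply: cvgV => //; rewrite mul1r invr_eq0 pnatr_eq0.
have L : (M n - D n) * 4^-1 * ('C(k n, 5)%:R / n%:R ^+ 5)^-1 @[n --> \oo] -->
    (K3K3_fun a - 0) * 4^-1 * (1 / 120)^-1.
  exact: (cvgM (cvgM (cvgB M_cvg D_cvg) (cvg_cst (4^-1 : R))) Ccvg').
apply: cvg_trans L; apply: near_eq_cvg; near=> n.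
have n0 : n%:R != 0 :> R by rewrite pnatr_eq0 -lt0n; near: n; exact: nbhs_infty_gt.
rewrite lambdaE -/(k n) /D /M.
have -> : (fun i => (part_size (c n) i)%:R / n%:R) = (fun i => n%:R^-1 * (part_size (c n) i)%:R) :> ('I_6 -> R).
  by apply/funext => i; rewrite mulrC.
rewrite K3K3_funZ -count_blowup count_P3K2_frames invf_div exprVn.
set Ci := ('C(k n, 5)%:R)^-1; set X := (induced_count _ _)%:R; set F := frames _ _.
by field.
Unshelve. all: by end_near. Qed.

End Limits.

(** * The limit 5/18 and the unique maximiser *)

Section Max.
Variable R : realType.
Local Notation lam := (lambda (@gamma_P3K2 R)).
Local Notation lmax := (lambda_max no_forbidden_graph (@gamma_P3K2 R)).

(** The bound of [copies_le] as a density, valid at every order; it tends to 120/432 = 5/18. *)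
Definition lambda_upper (n : nat) : R := n%:R ^+ 5 / 432 / 'C(n, 5)%:R.

Lemma lambda_le_upper n (G : graph 'I_n) : lam G <= lambda_upper n.
Proof.
rewrite lambdaE /lambda_upper card_ord; apply: ler_wpM2r; first by rewrite invr_ge0.
by have := copies_le R G; rewrite card_ord.
Qed.

Lemma lambda_le_max n (G : graph 'I_n) : lam G <= lmax n.
Proof.
apply: ub_le_sup; last by exists G => // k F [].
by exists (lambda_upper n) => _ [H _ <-]; exact: lambda_le_upper.
Qed.

Lemma lambda_max_le_upper n : lmax n <= lambda_upper n.
Proof.
apply: ge_sup; last by move=> _ [H _ <-]; exact: lambda_le_upper.
by exists (lam (graph_of (fun _ _ : 'I_n => false))), (graph_of (fun _ _ : 'I_n => false)) => // k F [].
Qed.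

Lemma bin5_cvg : 'C(n, 5)%:R / n%:R ^+ 5 @[n --> \oo] --> (1 / 120 : R).
Proof. by apply: (@bin5_ratio_cvg _ id 0) => n; rewrite subrr normr0. Qed.

Lemma lambda_upper_cvg : lambda_upper n @[n --> \oo] --> (5 / 18 : R).
Proof.
have C : ('C(n, 5)%:R / n%:R ^+ 5)^-1 @[n --> \oo] --> ((1 / 120)^-1 : R).
  by apply: cvgV; [rewrite mul1r invr_eq0 pnatr_eq0 | exact: bin5_cvg].
have -> : (5 / 18 : R) = 432^-1 * (1 / 120)^-1 by field.
apply: cvg_trans (cvgM (cvg_cst (432^-1 : R)) C).
by apply: near_eq_cvg; near=> n; rewrite /lambda_upper /= invf_div; ring.
Unshelve. all: by end_near. Qed.

Definition residue_part (n : nat) (v : 'I_n) : 'I_6 := inord (v %% 6).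

Lemma part_size_residue n (i : 'I_6) : part_size (@residue_part n) i = ((n + 5 - i) %/ 6)%N.
Proof.
have -> : part_size (@residue_part n) i = (\sum_(0 <= v < n) (v %% 6 == i))%N.
  rewrite big_mkord /part_size -sum1_card big_mkcond /=; apply: eq_bigr => v _.
  by rewrite inE /residue_part -(inj_eq val_inj) /= inordK ?ltn_mod //; case: eqP.
elim: n => [|n IH].
  by rewrite big_geq // add0n divn_small // ltnS leq_subr.
rewrite big_nat_recr //= IH; have := ltn_ord i; case: eqP; lia.
Qed.

Lemma lambda_residue_cvg : lam (blowup K3K3 (@residue_part n)) @[n --> \oo] --> (5 / 18 : R).
Proof.
have -> : (5 / 18 : R) = 30 * K3K3_fun (fun=> 1 / 6) by rewrite K3K3_fun_const; field.
apply: (@lambda_blowup_cvg _ (fun n => 'I_n) (fun n => @residue_part n) _ 1).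
  by rewrite sumr_const card_ord; field.
move=> n i; rewrite part_size_residue.
have : (n <= 6 * ((n + 5 - i) %/ 6) + 5)%N /\ (6 * ((n + 5 - i) %/ 6) <= n + 5)%N.
  by have := ltn_ord i; lia.
set q := (_ %/ 6)%N; have -> : (6 * q = q + q + q + q + q + q)%N by lia.
rewrite -!(ler_nat R) !natrD ler_norml => -[h1 h2].
by apply/andP; split; lra.
Qed.

Lemma lambda_max_cvg : lmax n @[n --> \oo] --> (5 / 18 : R).
Proof.
apply: (squeeze_cvgr _ lambda_residue_cvg lambda_upper_cvg).
by near=> n; rewrite lambda_le_max lambda_max_le_upper.
Unshelve. all: by end_near. Qed.

Lemma part_size_tag (s : 'I_6 -> nat) i :
  part_size (fun v : {i : 'I_6 & 'I_(s i)} => tag v) i = s i.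
Proof.
rewrite /part_size -[RHS]card_ord.
have inj : injective (fun x : 'I_(s i) => Tagged (fun i => 'I_(s i)) x).
  by move=> x y /eqP; rewrite -tag_eqE /tag_eq eqxx tagged_asE => /eqP.
rewrite -(card_codom inj); apply: eq_card => -[j x]; rewrite !inE /=.
apply/eqP/codomP => [ji|[y /(congr1 tag) //]].
by case: _ / ji x => x; exists x.
Qed.

Lemma is_lambda_blowup_K3K3 (a : 'rV[R]_6) : simplex a ->
  is_lambda_blowup (@gamma_P3K2 R) K3K3 a (30 * K3K3_fun (a 0)).
Proof.
case=> a0 a1 s [K sK].
apply: (@lambda_blowup_cvg _ (fun n => {i : 'I_6 & 'I_(s n i)}) (fun n v => tag v) _ K) => // n i.
by rewrite part_size_tag.
Qed.

Lemma lambda_blowupP (a : 'rV[R]_6) : simplex a ->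
  is_lambda_blowup (@gamma_P3K2 R) K3K3 a (lambda_blowup (@gamma_P3K2 R) K3K3 a).
Proof.
by move=> sa; apply: (@getPex _ (is_lambda_blowup (@gamma_P3K2 R) K3K3 a)); exists (30 * K3K3_fun (a 0)); exact: is_lambda_blowup_K3K3.
Qed.

Lemma lambda_blowup_K3K3 (a : 'rV[R]_6) : simplex a ->
  lambda_blowup (@gamma_P3K2 R) K3K3 a = 30 * K3K3_fun (a 0).
Proof.
move=> sa; have H1 := is_lambda_blowup_K3K3 sa; have H2 := lambda_blowupP sa.
(* [is_lambda_blowup] quantifies over size sequences, so uniqueness of its value needs one such
   sequence to exist; rounding down provides it. *)
pose s n i := Num.truncn (a 0 i * n%:R).
have sK : exists K : R, forall n i, `|(s n i)%:R - a 0 i * n%:R| <= K.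
  exists 1 => n i; have [a0 _] := sa.
  have /andP[h1] := truncn_itv (mulr_ge0 (a0 i) (ler0n R n)).
  by rewrite -natr1 ler_norml => h2; rewrite /s; lra.
exact: (cvg_unique _ (H2 s sK) (H1 s sK)).
Qed.

(** The flag inequality applied to the six-vertex graph [K3K3] itself, weighted by [S]. *)
Lemma K3K3_fun_le (S : 'I_6 -> R) : (forall i, 0 <= S i) -> \sum_i S i = 1 ->
  K3K3_fun S <= 1 / 108.
Proof.
move=> S0 S1; rewrite /K3K3_fun -psum_K3K3.
apply: le_trans (flag_inequality K3K3 S0) _; rewrite S1 expr1n gerBl.
apply: divr_ge0; last exact: ler0n.
apply: sumr_ge0 => f _; apply: mulr_ge0; [exact: prodr_ge0 | exact: ler0n].
Qed.

Lemma maximiser_K3K3 (a : 'rV[R]_6) :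
  is_maximiser (lambda_blowup (@gamma_P3K2 R) K3K3) a <-> a = const_mx (1 / 6).
Proof.
have sc : simplex (const_mx (1 / 6) : 'rV[R]_6).
  split=> [i|]; first by rewrite mxE divr_ge0.
  by under eq_bigr do rewrite mxE; rewrite sumr_const card_ord; field.
have fc : K3K3_fun ((const_mx (1 / 6) : 'rV[R]_6) 0) = 1 / 108.
  have -> : 1 / 108 = 1 ^+ 5 / 108 :> R by rewrite expr1n.
  rewrite -K3K3_fun_const; congr K3K3_fun.
  by apply/funext => i; rewrite mxE.
split=> [[sa aM]|->].
  have := aM _ sc; rewrite !lambda_blowup_K3K3 // fc ler_pM2l // => H.
  have [a0 a1] := sa.
  have h0 : (0 : R) < 1 / 288 by rewrite divr_gt0.
  (* Stability with [eps = 0] is uniqueness. *)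
  have := @K3K3_poly_stable R (a 0) 0 a0 a1 h0; rewrite mulr0 subr0 => /(_ H) E.
  apply/rowP => i; rewrite mxE; have := E i; rewrite mulr0 => h.
  by apply/eqP; rewrite -subr_eq0 -sqrf_eq0 eq_le h sqr_ge0.
split=> // b sb; rewrite !lambda_blowup_K3K3 // fc ler_pM2l //.
by case: sb => b0 b1; exact: K3K3_fun_le.
Qed.

End Max.

(** * Perfect stability *)

Section Stability.
Variable R : realType.

(** The constant is 31 = 5 + 10 + 10 + 5 + 1, the binomial coefficients of the powers of [d], each
    power being at most [d]. *)
Lemma prod5_near1 (x : 'I_5 -> R) d : 0 <= d -> d <= 1 -> (forall i, `|x i - 1| <= d) ->
  `|\prod_i x i - 1| <= 31 * d.
Proof.
move=> d0 d1 H.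
have B i : 1 - d <= x i <= 1 + d.
  by have := H i; rewrite ler_norml => /andP[? ?]; apply/andP; split; lra.
have U : \prod_i x i <= (1 + d) ^+ 5.
  have -> : (1 + d) ^+ 5 = \prod_(i < 5) (1 + d) by rewrite prodr_const card_ord.
  by apply: ler_prod => i _; have /andP[? ?] := B i; apply/andP; split; lra.
have L : (1 - d) ^+ 5 <= \prod_i x i.
  have -> : (1 - d) ^+ 5 = \prod_(i < 5) (1 - d) by rewrite prodr_const card_ord.
  by apply: ler_prod => i _; have /andP[? ?] := B i; apply/andP; split; lra.
have p k : 0 <= d ^+ k.+1 <= d.
  rewrite exprn_ge0 //=; elim: k => [|k IH]; first by rewrite expr1.
  by rewrite exprS; apply: le_trans IH; rewrite ler_piMl // exprn_ge0.
have := p 1%N; have := p 2%N; have := p 3%N; have := p 4%N.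
move=> /andP[p5 q5] /andP[p4 q4] /andP[p3 q3] /andP[p2 q2].
have EU : (1 + d) ^+ 5 = 1 + 5 * d + 10 * d ^+ 2 + 10 * d ^+ 3 + 5 * d ^+ 4 + d ^+ 5 by ring.
have EL : (1 - d) ^+ 5 = 1 - 5 * d + 10 * d ^+ 2 - 10 * d ^+ 3 + 5 * d ^+ 4 - d ^+ 5 by ring.
by rewrite ler_norml; apply/andP; split; lra.
Qed.

Lemma abs_le_of_sqr (x y : R) : 0 <= y -> x ^+ 2 <= y ^+ 2 -> `|x| <= y.
Proof. by move=> y0 h; rewrite -(ger0_norm y0) -ler_sqr ?nnegrE // !real_normK ?num_real. Qed.

Lemma inv_near1 (x d : R) : 0 <= d -> d <= 1 / 2 -> `|x - 1| <= d / 2 -> `|x^-1 - 1| <= d.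
Proof.
move=> d0 d1; rewrite !ler_norml => /andP[h1 h2].
have x0 : 0 < x by lra.
have e : x * x^-1 = 1 by rewrite divff // gt_eqF.
have i0 : 0 < x^-1 by rewrite invr_gt0.
by apply/andP; split; nra.
Qed.

Lemma discrepancyC (T : finType) (G H : graph T) : discrepancy R G H = discrepancy R H G.
Proof. by apply: eq_bigr => u _; apply: eq_bigr => v _; rewrite eq_sym. Qed.

(* Reweighting every part of the blow-up to the same total weight makes the
   blow-up attain equality in the flag inequality, while for G the obstructions
   created by misplaced pairs are lost. *)
Lemma reweighted_loss (T : finType) (G : graph T) (c : T -> 'I_6) (d : R) :
  0 <= d -> d <= 1 / 2 -> (0 < #|T|)%N ->
  (forall i, `|6 * ((part_size c i)%:R / #|T|%:R) - 1| <= d / 2) ->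
  count_pattern R G obstruction / 32 / 6000 - 31 * d * (20 * #|T|%:R ^+ 3 * misplaced R G c) <=
  count_pattern R (blowup K3K3 c) P3K2_pattern - count_pattern R G P3K2_pattern.
Proof.
move=> d0 d1 T0 near6; set H := blowup K3K3 c; set n : R := #|T|%:R.
have n0 : 0 < n by rewrite ltr0n.
pose w v := (6 * ((part_size c (c v))%:R / n))^-1.
have w1 v : `|w v - 1| <= d by apply: inv_near1.
have wge v : 1 / 2 <= w v by have := w1 v; rewrite ler_norml => /andP[]; lra.
have w0 v : 0 <= w v by apply: le_trans (wge v); rewrite divr_ge0.
have s0 i : (part_size c i)%:R != 0 :> R.
  apply/eqP => s0; have := near6 i; rewrite s0 mul0r mulr0 sub0r normrN normr1; lra.
have pw i : part_weight c w i = n / 6.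
  rewrite /part_weight (eq_bigr (fun=> (6 * ((part_size c i)%:R / n))^-1)); last first.
    by move=> v /eqP cv; rewrite /w cv.
  rewrite sumr_const -/(part_size c i) -mulr_natl; field.
  by rewrite s0 gt_eqF.
have wsum : \sum_v w v = n.
  rewrite (partition_big c xpredT) //= (eq_bigr (fun=> n / 6)) => [|i _]; last exact: pw.
  by rewrite sumr_const card_ord; field.
have wH : psum H w (fun e => (P3K2_pattern e)%:R) = n ^+ 5 / 108.
  rewrite psum_blowup_K3K3 -K3K3_fun_const; congr K3K3_fun; apply/funext => i; exact: pw.
have wG := flag_inequality G w0; rewrite wsum -wH in wG.
have k0 : (0 : R) < 6000 by rewrite ltr0n.
move: (6000 : R) k0 wG => k k0 wG.
(* All weights are at least 1/2, which costs the factor 1/32. *)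
have wO := @count_pattern_le_psum R T w (1 / 2) G obstruction (ltW (divr_gt0 ltr01 (ltr0n R 2))) wge.
have d1' : d <= 1 by apply: le_trans d1 _; rewrite ler_pdivrMr // mul1r ler1n.
(* The weight error multiplies a difference of indicators that vanishes wherever the two graphs
   agree. It thus costs [d] times the misplaced pairs, not [d n^5]. *)
have := @weighted_diff R T P3K2_pattern H G (fun f : {ffun 'I_5 -> T} => \prod_i w (f i) - 1) (31 * d)
  eqpat5_P3K2 (fun f : {ffun 'I_5 -> T} => prod5_near1 d0 d1' (fun i => w1 (f i))).
rewrite discrepancyC -misplaced_discrepancy -/n.
have -> : \sum_(f : {ffun 'I_5 -> T}) (\prod_i w (f i) - 1) * ((P3K2_pattern (pat H f))%:R - (P3K2_pattern (pat G f))%:R) =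
  psum H w (fun e => (P3K2_pattern e)%:R) - psum G w (fun e => (P3K2_pattern e)%:R) -
  (count_pattern R H P3K2_pattern - count_pattern R G P3K2_pattern).
  by rewrite !count_patternE /psum -!sumrB; apply: eq_bigr => f _; ring.
move: (_ * misplaced R G c) => X.
rewrite ler_norml => /andP[_ h].
have h32 : (1 / 2 : R) ^+ 5 = 1 / 32 by field.
rewrite h32 in wO.
set M1 := count_pattern R G obstruction in wO *; set M2 := psum G w _ in wO wG.
have wO' : M1 / 32 / k <= M2 / k.
  by apply: ler_wpM2r; [rewrite invr_ge0 ltW | rewrite mulrC; move: wO; rewrite div1r].
move: (M1 / 32 / k) (M2 / k) wO' wG h => a b.
lra.
Qed.

(** A placement with fewest misplaced pairs does at least as well as those of all the 2K2. *)
Lemma exists_placement (T : finType) (G : graph T) : exists c : T -> 'I_6,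
  misplaced R G c * count_pattern R G P3K2_pattern <= 16 * #|T|%:R ^+ 2 * count_pattern R G obstruction.
Proof.
have [f _ fmin] := @arg_minP _ R {ffun T -> 'I_6} [ffun=> ord0] xpredT (fun f => misplaced R G f) isT.
have misplaced_ffun (c : T -> 'I_6) : misplaced R G [ffun x => c x] = misplaced R G c.
  by apply: eq_bigr => u _; apply: eq_bigr => v _; rewrite !ffunE.
have fm c : misplaced R G f <= misplaced R G c.
  by rewrite -(misplaced_ffun c); exact: fmin.
exists f; have H := misplaced_count fm.
have m0 : 0 <= misplaced R G f by do 2 (apply: sumr_ge0 => ? _).
apply: le_trans (ler_wpM2l m0 (count_P3K2_two_edges R G)) _.
rewrite mulrCA expr2 (_ : 16 * (_ * _) * _ = #|T|%:R * (16 * #|T|%:R * count_pattern R G obstruction)).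
  by apply: ler_wpM2l.
by ring.
Qed.

(** Hides 6000 behind one [k] serving both bounds, so that the later choice of constants stays
    symbolic. *)
Lemma count_obstruction_le : exists2 k : R, 1 <= k &
  (forall (T : finType) (G : graph T), count_pattern R G obstruction / k <=
    #|T|%:R ^+ 5 / 108 - count_pattern R G P3K2_pattern) /\
  (forall (T : finType) (G : graph T) (c : T -> 'I_6) (d : R),
    0 <= d -> d <= 1 / 2 -> (0 < #|T|)%N ->
    (forall i, `|6 * ((part_size c i)%:R / #|T|%:R) - 1| <= d / 2) ->
    count_pattern R G obstruction / 32 / k - 31 * d * (20 * #|T|%:R ^+ 3 * misplaced R G c) <=
    count_pattern R (blowup K3K3 c) P3K2_pattern - count_pattern R G P3K2_pattern).
Proof.
exists 6000; first by rewrite ler1n.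
split=> [T G|]; last exact: reweighted_loss.
have := @flag_inequality R T G (fun=> 1) (fun=> ler01); rewrite sumr_const.
rewrite -/(count_pattern R G P3K2_pattern) -/(count_pattern R G obstruction).
move: (_ / 6000) => b; lra.
Qed.

Lemma stability_core : exists q e0 n0 : R, [/\ 0 < q, 0 < e0 &
  forall (T : finType) (G : graph T), n0 <= #|T|%:R -> (0 < #|T|)%N ->
    (1 / 108 - e0) * #|T|%:R ^+ 5 <= count_pattern R G P3K2_pattern ->
    exists c : T -> 'I_6, q * (#|T|%:R ^+ 3 * misplaced R G c) <=
      4 * ((induced_count P3K2 (blowup K3K3 c))%:R - (induced_count P3K2 G)%:R)].
Proof.
have [k k1 [flagk lossk]] := count_obstruction_le.
(* [A] will bound [n^3 W] by [A * O]: 16 comes from the placement, 125 from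
   [1/108 - 1/1000 > 1/125]. Then [q] gives [O / 32 / k = q * (A * O)], [d] makes the reweighting
   error [31 * d * 20] equal to [q / 4], and [eps] makes [25 * eps] equal to [(d / 12)^2]. *)
have [A A1 AE] : exists2 A : R, 1 <= A & A = 16 * 125 by exists (16 * 125) => //; lra.
have [q qE] : exists q : R, q = (A * 32 * k)^-1 by exists (A * 32 * k)^-1.
have [d dE] : exists d : R, d = q / 31 / 80 by exists (q / 31 / 80).
have [eps epsE] : exists eps : R, eps = (d / 60) ^+ 2 by exists ((d / 60) ^+ 2).
have Ak : 1 <= A * 32 * k by nra.
have q0 : 0 < q by rewrite qE invr_gt0; lra.
have q1 : q <= 1 by rewrite qE invf_le1 //; lra.
have d0 : 0 < d by rewrite dE !divr_gt0.
have d12 : d <= 1 / 2 by rewrite dE; lra.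
have eps0 : 0 < eps by rewrite epsE exprn_gt0 // divr_gt0.
have eps1 : eps <= 1 / 1000 by rewrite epsE expr2; nra.
(* Passing from [G] to its blow-up enlarges the deficit [e0] at most by the factor [B]; the product
   [2/27 * eps] is what [K3K3_poly_stable] tolerates. *)
have [B BE] : exists B : R, B = 1 + 20 * A * k by exists (1 + 20 * A * k).
have B1 : 1 <= B by rewrite BE; nra.
have [e0 e0E] : exists e0 : R, e0 = 2 / 27 * eps / B by exists (2 / 27 * eps / B).
have e00 : 0 < e0 by rewrite e0E divr_gt0 //; lra.
have eB : e0 * B = 2 / 27 * eps by rewrite e0E divfK // gt_eqF //; lra.
have e01 : e0 <= 1 / 1000 by nra.
(* Of the gain [q], one quarter pays for dropping the weights and one, once [n >= 24 / q], for the
   change in [frames]. *)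
exists (q / 2), e0, (24 / q); split=> //; first by rewrite divr_gt0.
move=> T G nq T0 HM; have [c Hc] := exists_placement G; exists c.
set n : R := #|T|%:R in nq HM Hc *; have n0 : 0 < n by rewrite ltr0n.
have fl := flagk T G; rewrite -/n in fl.
set M := count_pattern R G P3K2_pattern in HM Hc fl.
set O := count_pattern R G obstruction in Hc fl.
set W := misplaced R G c in Hc *.
have W0 : 0 <= W by do 2 (apply: sumr_ge0 => ? _).
have n5 : 0 < n ^+ 5 by rewrite exprn_gt0.
have n2 : 0 < n ^+ 2 by rewrite exprn_gt0.
have WO : n ^+ 3 * W <= A * O.
  have MW : n ^+ 5 / 125 * W <= W * M.
    by rewrite mulrC; apply: ler_wpM2l => //; apply: le_trans HM; move: (n ^+ 5) n5 => N N0; nra.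
  rewrite -(ler_pM2l n2).
  have -> : n ^+ 2 * (n ^+ 3 * W) = 125 * (n ^+ 5 / 125 * W) by field.
  have -> : n ^+ 2 * (A * O) = 125 * (16 * n ^+ 2 * O) by rewrite AE; ring.
  by rewrite ler_pM2l //; apply: le_trans MW Hc.
have k0 : 0 < k by lra.
have Oe : O <= k * (e0 * n ^+ 5).
  by rewrite mulrC -ler_pdivrMr //; lra.
have W5 : n ^+ 3 * W <= A * k * e0 * n ^+ 5.
  have -> : A * k * e0 * n ^+ 5 = A * (k * (e0 * n ^+ 5)) by ring.
  have A0 : 0 < A by lra.
  by apply: le_trans WO _; rewrite ler_pM2l.
set H := blowup K3K3 c.
have dHG : `|count_pattern R H P3K2_pattern - M| <= 20 * (n ^+ 3 * W).
  have := @weighted_diff R T P3K2_pattern H G (fun=> 1) 1 eqpat5_P3K2.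
  rewrite normr1 => /(_ (fun=> lexx _)); rewrite discrepancyC -misplaced_discrepancy mul1r -mulrA.
  congr (`|_| <= _); rewrite /M !count_patternE -sumrB; apply: eq_bigr => f _; exact: mul1r.
have MH : (1 / 108 - 2 / 27 * eps) * n ^+ 5 <= count_pattern R H P3K2_pattern.
  move: dHG; rewrite ler_norml => /andP[h _]; rewrite -eB BE.
  have : 20 * (n ^+ 3 * W) <= 20 * (A * k * e0 * n ^+ 5) by rewrite ler_pM2l.
  move: HM h; move: (n ^+ 3 * W) (n ^+ 5) (count_pattern R H _) => x y z; lra.
have near6 i : `|6 * ((part_size c i)%:R / n) - 1| <= d / 2.
  have S0 j : 0 <= n^-1 * (part_size c j)%:R by rewrite mulr_ge0 // invr_ge0 ltW.
  have S1 : \sum_j n^-1 * (part_size c j)%:R = 1.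
    by rewrite -mulr_sumr -natr_sum sum_part_size mulVf // gt_eqF.
  have e288 : eps < 1 / 288 by apply: le_lt_trans eps1 _; lra.
  have := K3K3_poly_stable S0 S1 e288.
  rewrite -/(K3K3_fun (fun j => n^-1 * (part_size c j)%:R)) K3K3_funZ -count_blowup -/H.
  have MH' : 1 / 108 - 2 / 27 * eps <= n^-1 ^+ 5 * count_pattern R H P3K2_pattern.
    by rewrite exprVn [X in _ <= X]mulrC ler_pdivlMr.
  move=> /(_ MH' i); rewrite [n^-1 * _]mulrC.
  have -> : 25 * eps = (d / 12) ^+ 2 by rewrite epsE; field.
  have d12' : 0 <= d / 12 by rewrite divr_ge0 // ltW.
  move=> /(abs_le_of_sqr d12'); rewrite !ler_norml => /andP[h1 h2]; apply/andP; split; lra.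
have := lossk T G c d (ltW d0) d12 T0 near6; rewrite -/n -/M -/O -/W -/H.
have OW : q * (n ^+ 3 * W) <= O / 32 / k.
  have -> : O / 32 / k = q * (A * O).
    by rewrite qE; field; rewrite gt_eqF //= gt_eqF //; lra.
  by rewrite ler_pM2l.
have fr := frames_diff R H G; rewrite discrepancyC -misplaced_discrepancy -/n -/W in fr.
have fr2 : 6 * n ^+ 2 * W <= q / 4 * (n ^+ 3 * W).
  have -> : q / 4 * (n ^+ 3 * W) = n * q / 4 * (n ^+ 2 * W) by field.
  rewrite -mulrA; apply: ler_wpM2r; first by rewrite mulr_ge0 ?sqr_ge0.
  have : 24 <= n * q by rewrite -ler_pdivrMr.
  by move: (n * q) => y; lra.
have := count_P3K2_frames R H; have := count_P3K2_frames R G; rewrite -/M.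
move=> -> ->.
have -> : 31 * d * (20 * n ^+ 3 * W) = q / 4 * (n ^+ 3 * W) by rewrite dE; field.
move: fr fr2 OW; move: (n ^+ 3 * W) (6 * n ^+ 2 * W) (O / 32 / k) => x y z.
move: (frames R H) (frames R G) (induced_count _ _)%:R (induced_count _ _)%:R => *; lra.
Qed.

End Stability.

(** * From misplaced pairs to the edit distance *)

Section Perfect.
Variable R : realType.

Lemma edit_count_le (T : finType) (G H : graph T) : (edit_count G H)%:R <= discrepancy R G H.
Proof.
have -> : discrepancy R G H = (#|[set p : T * T | adj G p.1 p.2 != adj H p.1 p.2]%SET|)%:R.
  rewrite /discrepancy pair_bigA /= -sum1_card natr_sum [RHS]big_mkcond /=.
  by apply: eq_bigr => p _; rewrite inE; case: (_ != _).
rewrite ler_nat /edit_count.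
apply: leq_trans (leq_imset_card (fun p : T * T => [set p.1; p.2]%SET) _).
apply: subset_leq_card; apply/fintype.subsetP => e; rewrite inE => /existsP[x /existsP[y /andP[/eqP -> xy]]].
by apply/imsetP; exists (x, y); rewrite ?inE.
Qed.

Lemma edit_distance_le n (G : graph 'I_n) (c : 'I_n -> 'I_6) :
  edit_distance R G K3K3 <= misplaced R G c / 'C(n, 2)%:R.
Proof.
rewrite /edit_distance card_ord; apply: ler_wpM2r; first by rewrite invr_ge0.
apply: le_trans (_ : (edit_count G (blowup K3K3 c))%:R <= _); last first.
  by rewrite misplaced_discrepancy edit_count_le.
apply: ge_inf; last by exists (blowup K3K3 c) => //; exists c.
by exists 0 => _ [H _ <-].
Qed.

Lemma misplaced_le (T : finType) (G : graph T) (c : T -> 'I_6) : misplaced R G c <= #|T|%:R ^+ 2.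
Proof.
apply: (@le_trans _ _ (\sum_(x : T) \sum_(y : T) 1)).
  by do 2 (apply: ler_sum => ? _); case: (_ != _).
by rewrite !sumr_const -mulrnA -natrX mulnn.
Qed.

Lemma bin2_ge (n : nat) : (2 <= n)%N -> n%:R ^+ 2 / 4 <= 'C(n, 2)%:R :> R.
Proof.
move=> n2; rewrite ler_pdivrMr // -natrX -natrM ler_nat bin2.
have := odd_double_half (n * n.-1).
have -> : odd (n * n.-1) = false by rewrite oddM; case: n {n2} => //= n; rewrite andNb.
move: (_./2) => h; case: n n2 => [|[|n]] // _; rewrite /= add0n -muln2 expnS expn1 => E.
have -> : (h * 4 = h * 2 * 2)%N by rewrite -mulnA.
by rewrite E -mulnA leq_mul2l /=; lia.
Qed.

Lemma bin5_le (n : nat) : 'C(n, 5)%:R <= n%:R ^+ 5 / 120 :> R.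
Proof.
rewrite ler_pdivlMr // -natrX -natrM ler_nat -[120%N]/(5`!) bin_ffact.
have p1 := leq_pred n; have p2 := leq_trans (leq_pred _) p1.
have p3 := leq_trans (leq_pred _) p2; have p4 := leq_trans (leq_pred _) p3.
by rewrite !ffactnS ffactn0 muln1 !expnS expn0 muln1 !leq_mul.
Qed.

(** The cross-multiplied form of [W / b2 <= C * (N1 - N2) / b5]: the factor [n^3] in the gain
    matches the ratio of the two binomials. *)
Lemma edit_vs_loss (C q W n b2 b5 N1 N2 : R) : 0 < C -> 0 <= q -> 1 <= C * q ->
  0 <= W -> 0 <= n -> b5 <= n ^+ 5 / 120 -> n ^+ 2 / 4 <= b2 ->
  q * (n ^+ 3 * W) <= 4 * (N1 - N2) -> W * b5 <= C * (N1 - N2) * b2.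
Proof.
move=> C0 q0 qC W0 n0 B5 B2 Hc.
have n3 : 0 <= n ^+ 3 by rewrite exprn_ge0.
have h1 : W * b5 <= W * (n ^+ 5 / 120) by apply: ler_wpM2l.
have h2 : W * n ^+ 3 <= C * (4 * (N1 - N2)).
  apply: (@le_trans _ _ (C * (q * (n ^+ 3 * W)))); last by rewrite ler_pM2l.
  by rewrite mulrA [W * _]mulrC ler_peMl // mulr_ge0.
have h3 : 0 <= C * (N1 - N2).
  have : 0 <= W * n ^+ 3 by rewrite mulr_ge0.
  lra.
apply: le_trans h1 _.
have h4 : C * (N1 - N2) * (n ^+ 2 / 4) <= C * (N1 - N2) * b2.
  by apply: ler_wpM2l.
apply: le_trans h4.
have -> : W * (n ^+ 5 / 120) = W * n ^+ 3 * (n ^+ 2 / 120) by field.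
have n2 : 0 <= n ^+ 2 / 120 by rewrite divr_ge0 ?sqr_ge0.
apply: le_trans (ler_wpM2r n2 h2) _.
have : 0 <= C * (N1 - N2) * n ^+ 2 by rewrite mulr_ge0 ?sqr_ge0.
lra.
Qed.

Lemma K3K3_perfectly_stable : perfectly_stable no_forbidden_graph (@gamma_P3K2 R) K3K3.
Proof.
have [q [e0 [m0 [q0 e00 core]]]] := stability_core R.
(* The bound 1/18 keeps [5/18 - 2 * e1] nonnegative; [e0 / 2] keeps the tuple count of a graph
   within [2 * e1] of 5/18 above the threshold set by [e0]. *)
have [e1 [e10 e11 e12]] : exists e1 : R, [/\ 0 < e1, e1 <= e0 / 2 & e1 <= 1 / 18].
  exists (Num.min (e0 / 2) (1 / 18)); split; rewrite ?ge_min ?lexx ?orbT //.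
  by rewrite lt_min !divr_gt0.
have [n1 _ H1] : \forall n \near \oo, 5 / 18 - e1 < lambda_max no_forbidden_graph (@gamma_P3K2 R) n.
  by apply: (cvgr_gt _ (@lambda_max_cvg R)); lra.
have [n2 _ H2] : \forall n \near \oo, 1 / 120 - e0 / 4 < 'C(n, 5)%:R / n%:R ^+ 5 :> R.
  by apply: (cvgr_gt _ (@bin5_cvg R)); lra.
pose C := 1 / q + 4 / e1 + `|m0| + n1%:R + n2%:R + 5.
have t1 : 0 < 1 / q by rewrite divr_gt0.
have t2 : 0 < 4 / e1 by rewrite divr_gt0.
have t3 : 0 <= n1%:R :> R by [].
have t4 : 0 <= n2%:R :> R by [].
have t5 := normr_ge0 m0.
exists C; first by rewrite /C; lra.
move=> n G Cn _.
have n5 : (5 <= n)%N by rewrite -(ler_nat R); apply: le_trans Cn; rewrite /C; lra.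
have nn1 : (n1 <= n)%N by rewrite -(ler_nat R); apply: le_trans Cn; rewrite /C; lra.
have nn2 : (n2 <= n)%N by rewrite -(ler_nat R); apply: le_trans Cn; rewrite /C; lra.
have nm0 : m0 <= n%:R.
  by apply: le_trans (ler_norm m0) _; apply: le_trans Cn; rewrite /C; lra.
have C1 : 1 / q <= C by rewrite /C; lra.
have C2 : 4 / e1 <= C by rewrite /C; lra.
clearbody C; clear t1 t2 t3 t4 t5.
have n0 : 0 < n%:R :> R by rewrite ltr0n; apply: leq_trans n5.
have b2 := bin2_ge (leq_trans (isT : (2 <= 5)%N) n5).
have b20 : 0 < 'C(n, 2)%:R :> R by rewrite ltr0n bin_gt0; apply: leq_trans n5.
have b50 : 0 < 'C(n, 5)%:R :> R by rewrite ltr0n bin_gt0.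
have C0 : 0 < C by apply: lt_le_trans C1; rewrite divr_gt0.
(* A gap of at least [e1] is absorbed by [C], since no edit distance exceeds 4: at most [n^2]
   ordered pairs are misplaced, and the binomial is at least [n^2 / 4]. *)
have [big|small] := leP e1 (lambda_max no_forbidden_graph (@gamma_P3K2 R) n - lambda (@gamma_P3K2 R) G).
  apply: le_trans (edit_distance_le G (fun=> ord0)) _.
  apply: (@le_trans _ _ 4).
    rewrite ler_pdivrMr //; apply: le_trans (misplaced_le _ _) _; rewrite card_ord; lra.
  have : 4 <= C * e1 by rewrite -ler_pdivrMr.
  by move/le_trans; apply; rewrite ler_pM2l.
have lG : 5 / 18 - 2 * e1 <= lambda (@gamma_P3K2 R) G by have := H1 n nn1; lra.
have cG : (1 / 108 - e0) * #|'I_n|%:R ^+ 5 <= count_pattern R G P3K2_pattern.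
  rewrite card_ord count_P3K2_frames.
  have f0 : 0 <= frames R G by do 4 (apply: sumr_ge0 => ? _).
  apply: (@le_trans _ _ (4 * (induced_count P3K2 G)%:R)); last by rewrite lerDl.
  have := H2 n nn2 => /ltW h2; rewrite lambdaE card_ord in lG.
  rewrite ler_pdivlMr // in lG; rewrite ler_pdivlMr ?exprn_gt0 // in h2.
  have p5 : 0 < n%:R ^+ 5 :> R by rewrite exprn_gt0.
  have f5 : 0 <= 5 / 18 - 2 * e1 by lra.
  have := le_trans (ler_wpM2l f5 h2) lG.
  move: (induced_count _ _)%:R (n%:R ^+ 5) p5 => N N5 p5 h.
  have : (1 / 108 - e0) * N5 <= 4 * ((5 / 18 - 2 * e1) * ((1 / 120 - e0 / 4) * N5)).
    rewrite !mulrA ler_pM2r //; have := mulr_gt0 e00 e10; lra.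
  by move/le_trans; apply; rewrite ler_pM2l.
have [c] : exists c : 'I_n -> 'I_6, q * (#|'I_n|%:R ^+ 3 * misplaced R G c) <=
      4 * ((induced_count P3K2 (blowup K3K3 c))%:R - (induced_count P3K2 G)%:R).
  by apply: core => //; rewrite card_ord //; apply: leq_trans n5.
rewrite card_ord => Hc.
apply: le_trans (edit_distance_le G c) _.
have W0 : 0 <= misplaced R G c by do 2 (apply: sumr_ge0 => ? _).
(* The blow-up has order exactly [n], so it competes for the maximum at that order and no limit
   enters. *)
have lH := lambda_le_max R (blowup K3K3 c).
apply: (@le_trans _ _ (C * (lambda (@gamma_P3K2 R) (blowup K3K3 c) - lambda (@gamma_P3K2 R) G))); last first.
  by rewrite ler_pM2l // lerD2r.
rewrite !lambdaE card_ord -mulrBl mulrA ler_pdivrMr // mulrAC ler_pdivlMr //.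
have qC : 1 <= C * q by rewrite -ler_pdivrMr.
exact: (edit_vs_loss C0 (ltW q0) qC W0 (ltW n0) (bin5_le n) b2 Hc).
Qed.

End Perfect.

Theorem theorem1p8 (R : realType) :
  [/\ perfectly_stable no_forbidden_graph (@gamma_P3K2 R) K3K3,
      lambda_max no_forbidden_graph (@gamma_P3K2 R) n @[n --> \oo]
        --> (5 / 18 : R),
      (forall a : 'rV[R]_6, simplex a ->
         is_lambda_blowup (@gamma_P3K2 R) K3K3 a
           (lambda_blowup (@gamma_P3K2 R) K3K3 a)) &
      (forall a : 'rV[R]_6,
         is_maximiser (lambda_blowup (@gamma_P3K2 R) K3K3) a <->
         a = const_mx (1 / 6))].
Proof.
split.
- exact: K3K3_perfectly_stable.
- exact: lambda_max_cvg.
- exact: lambda_blowupP.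
- exact: maximiser_K3K3.
Qed.
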